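(* Let $(E,h)$ be a Griffiths semipositive Hermitian holomorphic vector bundle (of arbitrary rank) over a complex manifold. Then the second Chern form $c_2(E,h)$ is a positive $(2,2)$-form.
   Context: For a Hermitian holomorphic vector bundle $(E,h)$ of rank $r$ over a complex manifold $X$, let $\Theta(E,h) \in \mathcal{A}^{1,1}(X,\operatorname{End}(E))$ be its Chern curvature tensor. The Chern forms are $c_k(E,h) = \operatorname{tr}_{\operatorname{End}(\Lambda^k E)}\left( \Lambda^k \frac{i}{2\pi}\Theta(E,h)\right)$ for $0 \le k \le r$ (and $c_k(E,h)=0$ for $k>r$). $(E,h)$ is called Griffiths semipositive if for every $x\in X$, $v\in E_x$, $\tau\in T_{X,x}$ one has $\langle\Theta(E,h)_x\cdot v,v\rangle_h(\tau,\bar\tau)\ge 0$. Positivity of forms: let $V$ be a complex vector space of dimension $n$ with basis $(e_1,\dots,e_n)$ and dual basis $(e_1^\vee,\dots,e_n^\vee)$. A form $\nu\in\Lambda^{n,n}V^\vee$ is a positive volume form if $\nu = t\, i e_1^\vee\wedge\overline{e}_1^\vee\wedge\dots\wedge i e_n^\vee\wedge\overline{e}_n^\vee$ for some real $t\ge 0$ (independent of the basis). A real form $u$ of bidegree $(p,p)$ on $V$ is called positive if, with $q=n-p$, for every decomposable $\beta=\beta_1\wedge\dots\wedge\beta_q$ with $\beta_1,\dots,\beta_q\in V^\vee$, the form $u\wedge i^{q^2}\beta\wedge\bar\beta$ is a positive volume form. A real $(p,p)$-form on $X$ is positive if it is positive on $V=T_{X,x}$ for every $x\in X$. (So positivity is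 meant in the weak, non-strict sense.) *)

(* Defs.v *)
From HB Require Import structures.
From mathcomp Require Import all_boot all_order all_algebra.

Set Warnings "-notation-overridden,-ambiguous-paths,-notation-incompatible-prefix".
Set Implicit Arguments.
Unset Strict Implicit.
Unset Printing Implicit Defensive.
Import Order.TTheory GRing.Theory Num.Theory.
Local Open Scope ring_scope.

(* [u A] is the coefficient of e_A := e_(i_1) /\ ... /\ e_(i_k), where
   A = {i_1 < ... < i_k}. *)
Definition ext (K : comNzRingType) (N : nat) : Type :=
  {ffun {set 'I_N} -> K^o}.

#[warnings="-redundant-canonical-projection"]
HB.instance Definition _ K N :=
  GRing.Lmodule.copy (ext K N) {ffun {set 'I_N} -> K^o}.

Section ExteriorAlgebra.
Variables (K : comNzRingType) (N : nat).
Implicit Types (A B D F : {set 'I_N}) (u v w : ext K N).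

Definition ext_basis A : ext K N := [ffun D => (D == A)%:R].

Definition inversions A B : nat :=
  #|[set p : 'I_N * 'I_N | [&& p.1 \in A, p.2 \in B & (p.2 < p.1)%N]]|.

(* e_A /\ e_B = wedge_sign A B *: e_(A :|: B) *)
Definition wedge_sign A B : K :=
  if [disjoint A & B] then (-1) ^+ inversions A B else 0.

Definition wedge u v : ext K N :=
  [ffun D => \sum_A \sum_B (A :|: B == D)%:R * (wedge_sign A B * (u A * v B))].

Lemma inversionsUl A B D : [disjoint A & B] ->
  inversions (A :|: B) D = (inversions A D + inversions B D)%N.
Proof.
move=> dAB; rewrite /inversions.
set S := [set p | _]; set S1 := [set p | _]; set S2 := [set p | _].
have -> : S = S1 :|: S2.
  by apply/setP=> p; rewrite !inE andb_orl.
rewrite cardsU; suff -> : S1 :&: S2 = set0 by rewrite cards0 subn0.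
apply/setP=> p; rewrite !inE; apply/negP=> /andP[/and3P[pA _ _] /andP[pB _]].
by rewrite (disjointFr dAB pA) in pB.
Qed.

Lemma inversionsUr A B D : [disjoint B & D] ->
  inversions A (B :|: D) = (inversions A B + inversions A D)%N.
Proof.
move=> dBD; rewrite /inversions.
set S := [set p | _]; set S1 := [set p | _]; set S2 := [set p | _].
have -> : S = S1 :|: S2.
  by apply/setP=> p; rewrite !inE andb_orl andb_orr.
rewrite cardsU; suff -> : S1 :&: S2 = set0 by rewrite cards0 subn0.
apply/setP=> p; rewrite !inE.
apply/negP=> /andP[/and3P[_ pA _] /and3P[_ pB _]].
by rewrite (disjointFr dBD pA) in pB.
Qed.

Lemma wedge_signA A B D :
  wedge_sign A B * wedge_sign (A :|: B) D =
  wedge_sign B D * wedge_sign A (B :|: D).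
Proof.
rewrite /wedge_sign -!setI_eq0 setIUl setIUr !setU_eq0 !setI_eq0.
case: (boolP [disjoint A & B]) => dAB; case: (boolP [disjoint B & D]) => dBD;
  rewrite /= ?andbF ?andbT ?mul0r ?mulr0 //.
case: (boolP [disjoint A & D]) => dAD; rewrite ?mulr0 //.
by rewrite -!exprD inversionsUl // inversionsUr // addnA addnC addnA.
Qed.

Lemma wedge_signE0 A : wedge_sign set0 A = 1.
Proof.
rewrite /wedge_sign -setI_eq0 set0I eqxx (_ : inversions _ _ = 0%N) //.
by apply/eqP; rewrite cards_eq0; apply/eqP/setP=> p; rewrite !inE.
Qed.

Lemma wedge_sign0E A : wedge_sign A set0 = 1.
Proof.
rewrite /wedge_sign -setI_eq0 setI0 eqxx (_ : inversions _ _ = 0%N) //.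
by apply/eqP; rewrite cards_eq0; apply/eqP/setP=> p; rewrite !inE /= andbF.
Qed.

Lemma wedgeA : associative wedge.
Proof.
move=> u v w; apply/ffunP=> D; rewrite !ffunE.
transitivity (\sum_A \sum_B \sum_F ((A :|: B :|: F == D)%:R *
    (wedge_sign B F * wedge_sign A (B :|: F)) * (u A * v B * w F))).
  apply: eq_bigr => A _.
  under eq_bigr => G _ do rewrite ffunE !mulr_sumr.
  rewrite exchange_big; apply: eq_bigr => B _ /=.
  under eq_bigr => G _ do rewrite !mulr_sumr.
  rewrite exchange_big; apply: eq_bigr => F _ /=.
  rewrite (bigD1 (B :|: F)) //= big1 ?addr0 => [|G /negPf nG].
    rewrite eqxx mul1r setUA -!mulrA; congr (_ * _).
    by rewrite [u A * (wedge_sign _ _ * _)]mulrCA [LHS]mulrCA.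
  by rewrite [_ :|: _ == G]eq_sym nG mul0r !mulr0.
apply/esym; rewrite [LHS]exchange_big /=.
under eq_bigr => F _ do under eq_bigr => G _ do
  rewrite ffunE mulr_suml !mulr_sumr.
under eq_bigr => F _ do rewrite exchange_big.
rewrite exchange_big /=; apply: eq_bigr => A _.
under eq_bigr => F _ do under eq_bigr => G _ do
  rewrite mulr_suml !mulr_sumr.
under eq_bigr => F _ do rewrite exchange_big.
rewrite exchange_big /=; apply: eq_bigr => B _; apply: eq_bigr => F _.
rewrite (bigD1 (A :|: B)) //= big1 ?addr0 => [|G /negPf nG].
  by rewrite eqxx mul1r -wedge_signA; rewrite -!mulrA; congr (_ * _); rewrite mulrCA.
by rewrite [_ :|: _ == G]eq_sym nG !(mul0r, mulr0).
Qed.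

Lemma wedge1l : left_id (ext_basis set0) wedge.
Proof.
move=> u; apply/ffunP=> D; rewrite ffunE (bigD1 set0) //=.
rewrite [X in _ + X]big1 ?addr0.
  rewrite (bigD1 D) //= big1 ?addr0 => [|B nB]; rewrite set0U.
    by rewrite ffunE !eqxx !mul1r wedge_signE0 mul1r.
  by rewrite (negPf nB) mul0r.
by move=> A nA; apply: big1 => B _; rewrite ffunE (negPf nA) mul0r !mulr0.
Qed.

Lemma wedge1r : right_id (ext_basis set0) wedge.
Proof.
move=> u; apply/ffunP=> D; rewrite ffunE exchange_big (bigD1 set0) //=.
rewrite [X in _ + X]big1 ?addr0.
  rewrite (bigD1 D) //= big1 ?addr0 => [|B nB]; rewrite setU0.
    by rewrite ffunE !eqxx !mul1r wedge_sign0E mul1r mulr1.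
  by rewrite (negPf nB) mul0r.
by move=> A nA; apply: big1 => B _; rewrite ffunE (negPf nA) !mulr0.
Qed.

Lemma wedgeDl : left_distributive wedge +%R.
Proof.
move=> u v w; apply/ffunP=> D; rewrite !ffunE -big_split; apply: eq_bigr => A _.
rewrite -big_split; apply: eq_bigr => B _ /=.
by rewrite ffunE mulrDl !mulrDr.
Qed.

Lemma wedgeDr : right_distributive wedge +%R.
Proof.
move=> u v w; apply/ffunP=> D; rewrite !ffunE -big_split; apply: eq_bigr => A _.
rewrite -big_split; apply: eq_bigr => B _ /=.
by rewrite ffunE !mulrDr.
Qed.

Lemma ext1_neq0 : ext_basis set0 != 0.
Proof.
by apply/eqP=> /ffunP/(_ set0)/eqP; rewrite !ffunE eqxx oner_eq0.
Qed.

HB.instance Definition _ := GRing.Zmodule_isNzRing.Build (ext K N)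
  wedgeA wedge1l wedge1r wedgeDl wedgeDr ext1_neq0.

Lemma ext_scalerAl (c : K) u v : c *: (u * v) = (c *: u) * v.
Proof.
apply/ffunP=> D; rewrite !ffunE scaler_sumr; apply: eq_bigr => A _.
rewrite scaler_sumr; apply: eq_bigr => B _; rewrite ffunE.
rewrite /GRing.scale /= mulrCA; congr (_ * _).
by rewrite mulrCA; congr (_ * _); rewrite mulrA.
Qed.

HB.instance Definition _ :=
  GRing.Lmodule_isLalgebra.Build K (ext K N) ext_scalerAl.

Lemma ext_scalerAr (c : K) u v : c *: (u * v) = u * (c *: v).
Proof.
apply/ffunP=> D; rewrite !ffunE scaler_sumr; apply: eq_bigr => A _.
rewrite scaler_sumr; apply: eq_bigr => B _; rewrite ffunE.
rewrite /GRing.scale /= mulrCA; congr (_ * _).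
by rewrite mulrCA; congr (_ * _); rewrite mulrCA.
Qed.

HB.instance Definition _ :=
  GRing.Lalgebra_isAlgebra.Build K (ext K N) ext_scalerAr.

Definition ext_gen (i : 'I_N) : ext K N := ext_basis [set i].

End ExteriorAlgebra.

(* Imported only here: [classical_sets] shadows names of [finset]. *)
From mathcomp Require Import all_classical all_reals all_analysis.
From mathcomp Require Import complex.
Import numFieldNormedType.Exports.
Local Open Scope classical_set_scope.
Local Open Scope ring_scope.

(* The name makes the normed structure of a [numFieldType] canonical on the
   complex numbers; in its order, [0 <= z] says that z is real and >= 0. *)
Definition Cplx (R : realType) : numClosedFieldType := R[i].

Section Forms.
Variables (R : realType) (n : nat).
Local Notation C := (Cplx R).

Definition ofreal (t : R) : C := real_complex R t.

(* Lambda^* (V^\vee + \bar V^\vee), V = C^n *)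
Definition cform := ext C (n + n).

Definition dz (j : 'I_n) : cform := ext_gen C (lshift n j).
Definition dzbar (j : 'I_n) : cform := ext_gen C (rshift n j).

Definition swap_gen (k : 'I_(n + n)) : cform :=
  match fintype.split k with inl j => dzbar j | inr j => dz j end.

(* complex conjugation: antilinear, multiplicative, exchanging dz_j and
   dzbar_j; the product is taken in increasing order of k *)
Definition conj_form (u : cform) : cform :=
  \sum_(A : {set 'I_(n + n)})
    (u A)^* *: \prod_(k < n + n | k \in A) swap_gen k.

Definition has_bidegree (p q : nat) (u : cform) : Prop :=
  forall A : {set 'I_(n + n)}, u A != 0 ->
    #|[set j : 'I_n | lshift n j \in A]%SET| = p /\
    #|[set j : 'I_n | rshift n j \in A]%SET| = q.

Definition real_form (u : cform) : Prop := conj_form u = u.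

(* an element of V^\vee, given by its coordinates on dz_1, ..., dz_n *)
Definition linear_form (b : 'rV[C]_n) : cform := \sum_(k < n) b 0 k *: dz k.

Definition positive_volume_form (nu : cform) : Prop :=
  exists2 t : R, 0 <= t &
    nu = ofreal t *: \prod_(j < n) ('i *: (dz j * dzbar j)).

Definition positive_form (p : nat) (u : cform) : Prop :=
  [/\ has_bidegree p p u, real_form u &
      forall (q : nat) (b : 'I_q -> 'rV[C]_n), (p + q = n)%N ->
        let beta := \prod_(k < q) linear_form (b k) in
        positive_volume_form (u * ('i ^+ (q ^ 2) *: (beta * conj_form beta)))].

(* Basis vectors e_(f 0) /\ ... /\ e_(f (k-1)), f increasing, of Lambda^k of a
   free module of rank r. *)
Definition increasing (k r : nat) (f : {ffun 'I_k -> 'I_r}) : bool :=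
  [forall i : 'I_k, forall j : 'I_k, (i < j)%N ==> (f i < f j)%N].

(* entries of Lambda^k M on these basis vectors, and its trace; the entries of
   the matrices M of interest are 2-forms, which commute *)
Definition ext_power_entry k r (M : 'M[cform]_r) (f g : {ffun 'I_k -> 'I_r}) :=
  \det (mxsub f g M).

Definition tr_ext_power k r (M : 'M[cform]_r) : cform :=
  \sum_(f : {ffun 'I_k -> 'I_r} | increasing f) ext_power_entry M f f.

(* derivative at z of f : C^n -> C along the real direction v *)
Definition real_derivable (v : 'rV[C]_n) (f : 'rV[C]_n -> C) (z : 'rV[C]_n) :=
  derivable (fun t : R => complex.Re (f (z + ofreal t *: v))) 0 1 /\
  derivable (fun t : R => complex.Im (f (z + ofreal t *: v))) 0 1.

Definition real_deriv (v : 'rV[C]_n) (f : 'rV[C]_n -> C) (z : 'rV[C]_n) : C :=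
  ofreal (derive1 (fun t : R => complex.Re (f (z + ofreal t *: v))) 0) +
  'i * ofreal (derive1 (fun t : R => complex.Im (f (z + ofreal t *: v))) 0).

Definition smooth_on (U : set 'rV[C]_n) (f : 'rV[C]_n -> C) : Prop :=
  forall (vs : seq 'rV[C]_n) (z : 'rV[C]_n), U z ->
    {for z, continuous (foldr real_deriv f vs)} /\
    forall v, real_derivable v (foldr real_deriv f vs) z.

Definition partial_z (k : 'I_n) (f : 'rV[C]_n -> C) (z : 'rV[C]_n) : C :=
  (real_deriv (delta_mx 0 k) f z
   - 'i * real_deriv ('i *: delta_mx 0 k) f z) / 2.

Definition partial_zbar (k : 'I_n) (f : 'rV[C]_n -> C) (z : 'rV[C]_n) : C :=
  (real_deriv (delta_mx 0 k) f z
   + 'i * real_deriv ('i *: delta_mx 0 k) f z) / 2.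

End Forms.

Record complexManifold (R : realType) (n : nat) := ComplexManifold {
  carrier :> topologicalType;
  carrier_hausdorff : hausdorff_space carrier;
  carrier_second_countable : @second_countable carrier;
  chart : Type;
  chart_dom : chart -> set carrier;
  chart_map : chart -> carrier -> 'rV[Cplx R]_n;
  chart_inv : chart -> 'rV[Cplx R]_n -> carrier;
  chart_cover : forall x, exists a, chart_dom a x;
  chart_dom_open : forall a, open (chart_dom a);
  chart_image_open : forall a, open (chart_map a @` chart_dom a);
  chart_mapK : forall a x, chart_dom a x -> chart_inv a (chart_map a x) = x;
  chart_map_continuous : forall a x, chart_dom a x ->
    {for x, continuous (chart_map a)};
  chart_inv_continuous : forall a x, chart_dom a x ->
    {for chart_map a x, continuous (chart_inv a)};
  chart_change_holomorphic : forall a b x, chart_dom a x -> chart_dom b x ->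
    differentiable (fun z => chart_map b (chart_inv a z)) (chart_map a x)
}.

Arguments chart_dom {R n X} : rename.
Arguments chart_map {R n X} : rename.
Arguments chart_inv {R n X} : rename.

(* Differentiability is over [Cplx R], i.e. complex differentiability. *)
Definition holomorphic_on (R : realType) (n : nat) (X : complexManifold R n)
    (U : set X) (f : X -> Cplx R) : Prop :=
  forall a x, chart_dom a x -> U x ->
    differentiable (fun z => f (chart_inv a z)) (chart_map a x).

Definition smooth_on_manifold (R : realType) (n : nat)
    (X : complexManifold R n) (U : set X) (f : X -> Cplx R) : Prop :=
  forall a : chart X,
    smooth_on (chart_map a @` (chart_dom a `&` U)) (fun z => f (chart_inv a z)).

(* The holomorphic structure is given by a cover by local frames whose
   transition functions are holomorphic. *)
Record holomorphicBundle (R : realType) (n : nat) (X : complexManifold R n)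
    (r : nat) := HolomorphicBundle {
  fiber :> X -> vectType (Cplx R);
  trivialization : Type;
  triv_dom : trivialization -> set X;
  frame : trivialization -> forall x : X, r.-tuple (fiber x);
  triv_cover : forall x, exists s, triv_dom s x;
  triv_dom_open : forall s, open (triv_dom s);
  frame_basis : forall s x, triv_dom s x -> basis_of fullv (frame s x);
  transition_holomorphic : forall s t (l m : 'I_r),
    holomorphic_on (triv_dom s `&` triv_dom t)
      (fun x => coord (frame t x) m (tnth (frame s x) l))
}.

Record hermitianMetric (R : realType) (n : nat) (X : complexManifold R n)
    (r : nat) (E : holomorphicBundle X r) := HermitianMetric {
  herm :> forall x, E x -> E x -> Cplx R;
  herm_linear : forall x (c : Cplx R) (u v w : E x),
    herm (c *: u + v) w = c * herm u w + herm v w;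
  herm_sym : forall x (u v : E x), herm u v = (herm v u)^*;
  herm_pos : forall x (v : E x), v != 0 -> 0 < herm v v;
  herm_smooth : forall s (l m : 'I_r),
    smooth_on_manifold (triv_dom s)
      (fun x => herm (tnth (frame s x) l) (tnth (frame s x) m))
}.

Arguments herm {R n X r E} h x u v : rename.

Section ChernCurvature.
Variables (R : realType) (n : nat) (X : complexManifold R n) (r : nat).
Variables (E : holomorphicBundle X r) (h : hermitianMetric E).
Variables (a : chart X) (s : trivialization E).
Local Notation C := (Cplx R).

(* All matrices are in the frame e = [frame s] and the coordinates z of the
   chart [a]; the matrix M of an endomorphism is M e_l = \sum_m M_(l,m) e_m. *)

Definition gram (z : 'rV[C]_n) : 'M[C]_r :=
  \matrix_(l, m) h (chart_inv a z) (tnth (frame s (chart_inv a z)) l)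
                                   (tnth (frame s (chart_inv a z)) m).

(* The Chern connection D e_l = \sum_m A_(l,m) e_m is the one with A of type
   (1,0) and dH = A H + H A^*, H the Gram matrix; taking (1,0)-parts,
   A = \partial H H^-1 = \sum_j A_j dz_j. *)
Definition chern_connection (j : 'I_n) (z : 'rV[C]_n) : 'M[C]_r :=
  (\matrix_(l, m) partial_z j (fun w => gram w l m) z) *m invmx (gram z).

(* D^2 = dA - A /\ A is of type (1,1), so that
   Theta = \bar\partial A = \sum_(j, k) Theta_(j,k) dz_j /\ dzbar_k with
   Theta_(j,k) = - \partial A_j / \partial zbar_k. *)
Definition curvature_coef (x : X) (j k : 'I_n) : 'M[C]_r :=
  \matrix_(l, m)
    - partial_zbar k (fun z => chern_connection j z l m) (chart_map a x).

Definition curvature (x : X) : 'M[cform R n]_r :=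
  \matrix_(l, m) \sum_(j < n) \sum_(k < n)
    curvature_coef x j k l m *: (dz R j * dzbar R k).

(* Theta(tau, \bar tau) as an endomorphism of E_x, for the tangent vector
   \sum_j tau_j \partial / \partial z_j *)
Definition curvature_End (x : X) (tau : 'rV[C]_n) (v : E x) : E x :=
  \sum_(l < r) \sum_(m < r)
    (coord (frame s x) l v *
     \sum_(j < n) \sum_(k < n)
       curvature_coef x j k l m * (tau 0 j * (tau 0 k)^*))
    *: tnth (frame s x) m.

Definition chern_form (k : nat) (x : X) : cform R n :=
  tr_ext_power k
    (\matrix_(l, m) (('i / (2 * ofreal (pi : R))) *: curvature x l m)).

End ChernCurvature.

(* The tangent space of X at x is identified with C^n by any chart at x. *)
Definition griffiths_semipositive (R : realType) (n : nat)
    (X : complexManifold R n) (r : nat) (E : holomorphicBundle X r)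
    (h : hermitianMetric E) : Prop :=
  forall (a : chart X) (s : trivialization E) (x : X),
    chart_dom a x -> triv_dom s x ->
    forall (v : E x) (tau : 'rV[Cplx R]_n),
      0 <= h x (curvature_End h a s tau v) v.

Definition positive_chern_form (R : realType) (n : nat)
    (X : complexManifold R n) (r : nat) (E : holomorphicBundle X r)
    (h : hermitianMetric E) (k : nat) : Prop :=
  forall (a : chart X) (s : trivialization E) (x : X),
    chart_dom a x -> triv_dom s x ->
    positive_form k (chern_form h a s k x).

(* Main.v *)
Require Import Defs.
From HB Require Import structures.
From mathcomp Require Import all_classical all_reals all_analysis complex.
From mathcomp Require Import all_boot all_order all_algebra fingroup perm.
From mathcomp Require Import ring zify.
Set Implicit Arguments.
Unset Strict Implicit.
Unset Printing Implicit Defensive.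
Import Order.TTheory GRing.Theory Num.Theory.
Local Open Scope ring_scope.
Local Open Scope sesquilinear_scope.

(* The statement is linear algebra at a point. In a unitary frame, write
   Theta(x, y) for the matrix sum_(j, k) x_j \bar y_k Theta_(j,k). Wedging
   c_2 with i^(q^2) beta \bar beta, for beta decomposable of degree n - 2,
   restricts it to the common kernel of the factors of beta, with basis x, y,
   and gives a positive multiple of
     tr A tr C - |tr B|^2 - tr (A C) + tr (B B^* ),
   where A = Theta(x, x), B = Theta(x, y), C = Theta(y, y). This number does not
   change when y is replaced by y - c x, so one may assume tr B = 0 (if
   tr A = 0, this holds already since |tr B|^2 <= tr A tr C). Then tr (A C) <= tr A tr C, because
   A and C are positive semidefinite, and tr (B B^* ) >= 0. *)

(** * Semipositive Hermitian matrices *)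

Section SemipositiveMatrices.
Variables (C : numClosedFieldType).

(** For a > 0 the quadratic polynomial in [t] attains its minimum at t = conj(b) / a, where its
    value is (a c - |b|^2) / a. *)
Lemma discriminant_le (a b c : C) : 0 <= a -> 0 <= c ->
  (forall t : C, 0 <= c - t * b - t^* * b^* + t * t^* * a) -> b * b^* <= a * c.
Proof.
move=> a0 c0 H; have cr : c^* = c by apply/CrealP; rewrite ger0_real.
have ar : a^* = a by apply/CrealP; rewrite ger0_real.
have [az|an] := eqVneq a 0.
  have bb0 : 0 <= b * b^* by rewrite mul_conjC_ge0.
  rewrite az mul0r; have [->|bn] := eqVneq b 0; first by rewrite mul0r.
  have bbn : b * b^* != 0 by rewrite mulf_neq0 // conjC_eq0.
  (* With a = 0 the hypothesis is affine in [t], hence violated far out in the direction of conj(b):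
     at t = s conj(b) its value is c - 2 s |b|^2 = -1. *)
  set s := (c + 1) / (2 * (b * b^*)).
  have sr : s^* = s.
    apply/CrealP; rewrite ger0_real // divr_ge0 ?addr_ge0 ?ler01 //.
    by rewrite mulr_ge0 // ler0n.
  have := H (s * b^*); rewrite az mulr0 addr0 (rmorphM _ s). rewrite /= sr conjCK.
  have -> : c - s * b^* * b - s * b * b^* = -1.
    transitivity (c - s * (2 * (b * b^*))); first by ring.
    by rewrite /s divfK ?opprD ?addNKr ?addrA ?subrr ?add0r // mulf_neq0 ?pnatr_eq0.
  by rewrite oppr_ge0 ler10.
have := H (b^* / a); rewrite (rmorphM _ b^*) fmorphV /= conjCK ar.
have -> : c - b^* / a * b - b / a * b^* + b^* / a * (b / a) * a = (a * c - b * b^*) / a.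
  by field.
by rewrite pmulr_lge0 ?subr_ge0 // invr_gt0 lt_def an.
Qed.

Definition hform r (N : 'M[C]_r) (u v : 'rV[C]_r) : C := (u *m N *m v ^t*) 0 0.

Definition psd r (N : 'M[C]_r) : Prop := forall v, 0 <= hform N v v.

Section Forms.
Variable r : nat.
Implicit Types (N A B : 'M[C]_r) (u v w : 'rV[C]_r).

Lemma hformDl N u v w : hform N (u + v) w = hform N u w + hform N v w.
Proof. by rewrite /hform !mulmxDl [LHS]mxE. Qed.

Lemma hformZl N (c : C) u w : hform N (c *: u) w = c * hform N u w.
Proof. by rewrite /hform -!scalemxAl [LHS]mxE. Qed.

Lemma hform_conj N u v : hform N u v = (hform (N ^t*) v u)^*.
Proof.
have -> : hform N u v = ((u *m N *m v ^t*) ^t* 0 0)^*.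
  by rewrite [in RHS]mxE [in RHS]mxE conjCK.
by rewrite !trmx_mul !map_mxM /hform trmxCK mulmxA.
Qed.

Lemma hformDr N u v w : hform N w (u + v) = hform N w u + hform N w v.
Proof. by rewrite hform_conj hformDl rmorphD /= -!hform_conj. Qed.

Lemma hformZr N (c : C) u w : hform N w (c *: u) = c^* * hform N w u.
Proof. by rewrite hform_conj hformZl rmorphM /= -hform_conj. Qed.

Lemma hform_delta N i j : hform N (delta_mx 0 i) (delta_mx 0 j) = N i j.
Proof.
rewrite /hform trmx_delta map_delta_mx -rowE -colE.
by rewrite !mxE.
Qed.

Lemma hformBm A B u v : hform (A - B) u v = hform A u v - hform B u v.
Proof. by rewrite /hform mulmxBr mulmxBl [LHS]mxE [X in _ + X]mxE. Qed.

(** Polarization: the value at [d i + t *: d j] is conj(t) N_ij + t N_ji, and the choices t = 1 and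
    t = i together kill both entries. *)
Lemma hform_eq0 N : (forall v, hform N v v = 0) -> N = 0.
Proof.
move=> H; apply/matrixP=> i j; rewrite mxE.
set d := fun k : 'I_r => delta_mx 0 k : 'rV[C]_r.
have e t : t^* * N i j + t * N j i = 0.
  have := H (d i + t *: d j).
  rewrite hformDl !hformDr !hformZl !hformZr !hform_delta.
  have := H (d i); have := H (d j); rewrite !hform_delta => -> ->.
  by rewrite !mulr0 add0r addr0.
have := e 1; rewrite conjC1 !mul1r => /eqP; rewrite addr_eq0 => /eqP eN.
have := e 'i; rewrite conjCi eN mulNr mulrN opprK -mulr2n => /eqP.
by rewrite mulrn_eq0 /= mulf_eq0 (negPf (neq0Ci C)) /= => /eqP ->; rewrite oppr0.
Qed.

(** Symmetry is not part of [psd]; over the complex numbers it follows from real values on the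
    diagonal, because the adjoint then defines the same quadratic form and [hform_eq0] applies to
    the difference. *)
Lemma psd_herm N : psd N -> N ^t* = N.
Proof.
move=> pN; apply/eqP; rewrite -subr_eq0; apply/eqP/hform_eq0=> v.
rewrite hformBm [X in _ - X]hform_conj.
suff -> : (hform (N ^t*) v v)^* = hform (N ^t*) v v by rewrite subrr.
rewrite -hform_conj.
have /CrealP <- : hform N v v \is Num.real by rewrite ger0_real.
by rewrite [in LHS]hform_conj conjCK.
Qed.

Lemma psd_hermE N i j : psd N -> N j i = (N i j)^*.
Proof. by move=> /psd_herm {1}<-; rewrite !mxE. Qed.

Lemma psd_diag N i : psd N -> 0 <= N i i.
Proof. by move=> /(_ (delta_mx 0 i)); rewrite hform_delta. Qed.

Lemma psd_tr N : psd N -> 0 <= \tr N.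
Proof. by move=> pN; apply: sumr_ge0 => i _; apply: psd_diag. Qed.

Lemma psd_minor N i j : psd N -> N i j * (N i j)^* <= N i i * N j j.
Proof.
move=> pN; apply: discriminant_le; rewrite ?psd_diag // => t.
have := pN (delta_mx 0 j - t *: delta_mx 0 i).
rewrite -scaleNr hformDl !hformDr !hformZl !hformZr !hform_delta.
by rewrite (psd_hermE i j pN) rmorphN; congr (_ <= _); ring.
Qed.

(** The left side is 2 Re(x conj(y)) <= 2 |x| |y|, and the inequality between geometric and
    arithmetic means for a1 c2 and a2 c1 finishes. The comparison is made between squares, so that
    no root appears. *)
Lemma ReM_le (a1 a2 c1 c2 x y : C) : 0 <= a1 -> 0 <= a2 -> 0 <= c1 -> 0 <= c2 ->
  x * x^* <= a1 * a2 -> y * y^* <= c1 * c2 ->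
  x * y^* + x^* * y <= a1 * c2 + a2 * c1.
Proof.
move=> a10 a20 c10 c20 hx hy.
set z := x * y^*; have ez : x^* * y = z^* by rewrite rmorphM /= conjCK.
have s0 : 0 <= a1 * c2 + a2 * c1 by rewrite addr_ge0 ?mulr_ge0.
have r0 : z + z^* \is Num.real.
  by apply/CrealP; rewrite rmorphD /= conjCK addrC.
rewrite ez; apply: le_trans (real_ler_norm r0) _.
apply: le_trans (ler_normD _ _) _; rewrite norm_conjC.
rewrite -(ler_sqr (addr_ge0 (normr_ge0 _) (normr_ge0 _))) //.
have -> : (`|z| + `|z|) ^+ 2 = 4 * ((x * x^*) * (y * y^*)).
  transitivity (4 * `|z| ^+ 2); first by ring.
  by rewrite normCK /z rmorphM /= conjCK; ring.
have h1 : x * x^* * (y * y^*) <= (a1 * a2) * (c1 * c2).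
  by rewrite ler_pM // mul_conjC_ge0.
apply: (@le_trans _ _ (4 * ((a1 * a2) * (c1 * c2)))).
  by rewrite ler_wpM2l // ler0n.
rewrite -subr_ge0.
have -> : (a1 * c2 + a2 * c1) ^+ 2 - 4 * (a1 * a2 * (c1 * c2)) = (a1 * c2 - a2 * c1) ^+ 2.
  by ring.
by rewrite real_exprn_even_ge0 // rpredB // realM // ger0_real.
Qed.

(** Symmetrized in (i, j), twice the difference is the sum of A_ii B_jj + A_jj B_ii - 2 Re(A_ij
    conj(B_ij)). Each term is nonnegative by [ReM_le], fed with the principal 2 x 2 minors of A and
    B. *)
Lemma psd_trM A B : psd A -> psd B -> \tr (A *m B) <= \tr A * \tr B.
Proof.
move=> pA pB; rewrite -subr_ge0.
rewrite -(@pmulr_rge0 _ 2) ?ltr0n // mulr_natl mulr2n.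
have e1 : \tr A * \tr B - \tr (A *m B) = \sum_i \sum_j (A i i * B j j - A i j * B j i).
  rewrite /mxtrace mulr_suml -sumrB; apply: eq_bigr => i _.
  by rewrite mulr_sumr mxE -sumrB.
rewrite {1}e1 e1 [X in _ + X]exchange_big -big_split; apply: sumr_ge0 => i _ /=.
rewrite -big_split; apply: sumr_ge0 => j _ /=.
rewrite (psd_hermE i j pA) (psd_hermE i j pB).
have := ReM_le (psd_diag i pA) (psd_diag j pA) (psd_diag i pB) (psd_diag j pB)
  (psd_minor i j pA) (psd_minor i j pB).
rewrite -subr_ge0; congr (_ <= _); ring.
Qed.

(** This is Theta(y - t x, y - t x) when A = Theta(x, x), B = Theta(x, y) and N = Theta(y, y); see
    [contract_pencil]. *)
Definition pencil A B N (t : C) : 'M[C]_r :=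
  N - t *: B - t^* *: B ^t* + (t * t^*) *: A.

Lemma second_chern_ge0_tr0 A B N : psd A -> psd N -> \tr B = 0 ->
  0 <= \tr A * \tr N - \tr B * \tr (B ^t*)
       - (\tr (A *m N) - \tr (B *m B ^t*)).
Proof.
move=> pA pN ->; rewrite mul0r subr0 opprB addrA addrAC.
rewrite addr_ge0 // ?subr_ge0 ?psd_trM //.
apply: sumr_ge0 => i _; rewrite mxE; apply: sumr_ge0 => j _.
by rewrite !mxE mul_conjC_ge0.
Qed.

Lemma mxtrace_conj N : \tr (N ^t*) = (\tr N)^*.
Proof. by rewrite /mxtrace rmorph_sum; apply: eq_bigr => i _; rewrite !mxE. Qed.

(* The expression is invariant under (B, N) -> (B - t^* A, pencil t), so that
   B can be made traceless; then only \tr (A N) <= \tr A \tr N is left. *)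
Lemma second_chern_ge0 A B N : psd A -> psd N -> (forall t, psd (pencil A B N t)) ->
  0 <= \tr A * \tr N - \tr B * \tr (B ^t*)
       - (\tr (A *m N) - \tr (B *m B ^t*)).
Proof.
move=> pA pN pP; have [A0|An] := eqVneq (\tr A) 0.
  have : \tr B * (\tr B)^* <= \tr A * \tr N.
    apply: discriminant_le; rewrite ?psd_tr // => t.
    by have := psd_tr (pP t); rewrite !linearD !linearN !linearZ /= mxtrace_conj.
  rewrite {1}A0 mul0r => le0; apply: second_chern_ge0_tr0 => //.
  by apply/eqP; rewrite -mul_conjC_eq0 eq_le le0 mul_conjC_ge0.
set t := (\tr B)^* / \tr A; have trR : (\tr A)^* = \tr A.
  by apply/CrealP; rewrite ger0_real // psd_tr.
have tt : t^* = \tr B / \tr A by rewrite rmorphM fmorphV /= trR conjCK.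
have tr0 : \tr (B - t^* *: A) = 0.
  by rewrite linearB linearZ /= tt divfK ?subrr.
have := second_chern_ge0_tr0 pA (pP t) tr0.
have -> : (B - t^* *: A) ^t* = B ^t* - t *: A.
  rewrite linearB linearZ /= map_mxB map_mxZ /= conjCK.
  by rewrite (psd_herm pA).
rewrite /pencil !(mulmxDr, mulmxDl, mulmxN, mulNmx) -!scalemxAr -!scalemxAl.
rewrite !(mxtraceD, raddfN, mxtraceZ) /= -?scalemxAl.
rewrite !mxtraceZ (mxtrace_mulC B A); congr (_ <= _); ring.
Qed.
End Forms.

Lemma mxtrC_mul m n p (A : 'M[C]_(m, n)) (B : 'M[C]_(n, p)) :
  (A *m B) ^t* = B ^t* *m A ^t*.
Proof. by rewrite trmx_mul map_mxM. Qed.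

(** By the spectral theorem a unitary P diagonalizes H. The eigenvalues are the values of the form
    on the rows of P, hence positive, and dividing each row by the square root of its eigenvalue
    gives Q. *)
Lemma orthonormal_basis_exists r (H : 'M[C]_r) :
  (forall v, v != 0 -> 0 < hform H v v) ->
  exists2 Q : 'M[C]_r, Q \in unitmx & Q *m H *m Q ^t* = 1%:M.
Proof.
move=> Hpos; have Hpsd : psd H.
  move=> v; have [->|/Hpos/ltW//] := eqVneq v 0.
  by rewrite /hform mul0mx mul0mx mxE.
have /orthomx_spectralP/esym HE : H \is normalmx.
  by apply/normalmxP; rewrite psd_herm.
move: HE (spectral_unitarymx H) (spectral_unit H).
move: (spectralmx H) (spectral_diag H) => P d HE Pu Pi.
have PHP : P *m H *m P ^t* = diag_mx d.
  by rewrite -invmx_unitary // -HE !mulmxA mulmxV // mul1mx -mulmxA mulmxV // mulmx1.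
have dpos i : 0 < d 0 i.
  have -> : d 0 i = hform H (row i P) (row i P).
    rewrite /hform -[row i P]mul1mx -[1%:M *m _]/(1%:M *m row i P).
    rewrite mul1mx rowE mxtrC_mul !mulmxA -(mulmxA _ P) -(mulmxA _ (P *m H)) PHP.
    by rewrite -/(hform _ _ _) hform_delta mxE eqxx mulr1n.
  apply: Hpos; apply/eqP=> /(congr1 (mulmx^~ (invmx P))).
  rewrite mul0mx rowE -mulmxA mulmxV // mulmx1 => /rowP/(_ i)/eqP.
  by rewrite !mxE !eqxx oner_eq0.
pose e := \row_i (sqrtC (d 0 i))^-1.
have e_neq0 i : sqrtC (d 0 i) != 0 by rewrite sqrtC_eq0 gt_eqF.
exists (diag_mx e *m P).
  rewrite unitmx_mul Pi andbT unitmxE det_diag unitfE.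
  by apply/prodf_neq0 => i _; rewrite mxE invr_eq0.
rewrite mxtrC_mul !mulmxA -(mulmxA _ P) -(mulmxA _ (P *m H)) PHP.
rewrite tr_diag_mx map_diag_mx !mulmx_diag -diag_const_mx; congr diag_mx.
apply/rowP=> i; rewrite !mxE /=.
have /CrealP -> : (sqrtC (d 0 i))^-1 \is Num.real.
  by rewrite ger0_real // invr_ge0 sqrtC_ge0 ltW.
by rewrite -{2}[d 0 i]sqrtCK; field.
Qed.

(** * Contractions of the curvature coefficients *)

Section Curvature.
Variables (n r : nat).
Implicit Types (T : 'I_n -> 'I_n -> 'M[C]_r) (x y : 'rV[C]_n).

Definition herm_contract T x y : 'M[C]_r :=
  \sum_j \sum_k (x 0 j * (y 0 k)^*) *: T j k.

(** The coefficient of dz_j dzbar_k dz_j' dzbar_k' in (tr Theta)^2 - tr(Theta^2), which is 2 c_2 up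
    to the factor (i / 2 pi)^2. *)
Definition second_chern_coef T (j k j' k' : 'I_n) : C :=
  \tr (T j k) * \tr (T j' k') - \tr (T j k *m T j' k').

Lemma contractE T x y l m :
  herm_contract T x y l m = hform (\matrix_(j, k) T j k l m) x y.
Proof.
rewrite /hform /herm_contract summxE mxE; under [RHS]eq_bigr => k _ do rewrite mxE mulr_suml.
rewrite exchange_big; apply: eq_bigr => j _; rewrite summxE; apply: eq_bigr => k _.
by rewrite !mxE mulrAC.
Qed.

Lemma contract_pencil T x y t :
  herm_contract T (y - t *: x) (y - t *: x) =
  herm_contract T y y - t *: herm_contract T x y - t^* *: herm_contract T y x
  + (t * t^*) *: herm_contract T x x.
Proof.
apply/matrixP=> l m; rewrite !(mxE, contractE).
rewrite -scaleNr hformDl !hformDr !hformZl !hformZr rmorphN /=; ring.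
Qed.

Lemma contract_conjmx T (Q P : 'M[C]_r) x y :
  herm_contract (fun j k => Q *m T j k *m P) x y = Q *m herm_contract T x y *m P.
Proof.
rewrite /herm_contract mulmx_sumr mulmx_suml; apply: eq_bigr => j _.
rewrite mulmx_sumr mulmx_suml; apply: eq_bigr => k _.
by rewrite -scalemxAr -scalemxAl.
Qed.

(** Theta(x, x) is Hermitian for every x. For fixed l and m this says that a sesquilinear form in x,
    with matrix [K], vanishes on the diagonal, so polarization in x gives the symmetry of the
    individual coefficients. *)
Lemma psd_contract_herm T j k : (forall x, psd (herm_contract T x x)) ->
  T k j = (T j k) ^t*.
Proof.
move=> pT; apply/matrixP=> l m; rewrite !mxE; apply/eqP; rewrite -subr_eq0.
pose K := \matrix_(j, k) T j k l m - (\matrix_(j, k) T j k m l) ^t*.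
suff /matrixP/(_ k j) : K = 0 by rewrite !mxE => ->.
apply: hform_eq0 => x; rewrite /K hformBm [X in _ - X]hform_conj trmxCK.
by rewrite -!contractE -psd_hermE // subrr.
Qed.

Section UnitaryFrame.
Variable T : 'I_n -> 'I_n -> 'M[C]_r.
Hypothesis pT : forall x, psd (herm_contract T x x).

Lemma second_chern_coef_conj j k j' k' :
  (second_chern_coef T j k j' k')^* = second_chern_coef T k j k' j'.
Proof.
rewrite /second_chern_coef rmorphB rmorphM /= -!mxtrace_conj mxtrC_mul.
by rewrite -!(psd_contract_herm _ _ pT) mxtrace_mulC.
Qed.

Lemma second_chern_contract_ge0 x y :
  0 <= \tr (herm_contract T x x) * \tr (herm_contract T y y)
       - \tr (herm_contract T x y) * \tr (herm_contract T y x)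
       - (\tr (herm_contract T x x *m herm_contract T y y)
          - \tr (herm_contract T x y *m herm_contract T y x)).
Proof.
have Bherm : herm_contract T y x = (herm_contract T x y) ^t*.
  apply/matrixP=> l m; rewrite 2!mxE contractE hform_conj contractE.
  congr (hform _ _ _)^*; apply/matrixP=> j k; rewrite !mxE.
  by rewrite (psd_contract_herm j k pT) !mxE conjCK.
rewrite Bherm; apply: second_chern_ge0 => // t.
by rewrite /pencil -Bherm -contract_pencil.
Qed.
End UnitaryFrame.

(** * From a unitary frame to an arbitrary one *)

Section ArbitraryFrame.
Variables (T : 'I_n -> 'I_n -> 'M[C]_r) (H : 'M[C]_r).
Hypothesis H_pos : forall v, v != 0 -> 0 < hform H v v.
Hypothesis T_pos : forall x, psd (herm_contract T x x *m H).

Lemma unitary_frame_exists : exists2 T' : 'I_n -> 'I_n -> 'M[C]_r,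
  forall x, psd (herm_contract T' x x) &
  exists2 Q : 'M[C]_r, Q \in unitmx &
    forall x y, herm_contract T' x y = Q *m herm_contract T x y *m invmx Q.
Proof.
have [Q Qu QHQ] := orthonormal_basis_exists H_pos.
exists (fun j k => Q *m T j k *m invmx Q) => [x v|]; last first.
  by exists Q => // x y; rewrite contract_conjmx.
rewrite contract_conjmx /hform.
have -> : invmx Q = H *m Q ^t*.
  by rewrite -[RHS]mul1mx -(mulVmx Qu) -!mulmxA [Q *m _]mulmxA QHQ mulmx1.
have := T_pos x (v *m Q); rewrite /hform mxtrC_mul.
by rewrite !mulmxA.
Qed.

Lemma mxtrace_conjmx (Q A : 'M[C]_r) : Q \in unitmx ->
  \tr (Q *m A *m invmx Q) = \tr A.
Proof. by move=> Qu; rewrite mxtrace_mulC mulmxA mulVmx // mul1mx. Qed.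

Lemma mulmx_conjmx (Q A B : 'M[C]_r) : Q \in unitmx ->
  (Q *m A *m invmx Q) *m (Q *m B *m invmx Q) = Q *m (A *m B) *m invmx Q.
Proof. by move=> Qu; rewrite !mulmxA mulmxKV. Qed.

Lemma contract_delta (T' : 'I_n -> 'I_n -> 'M[C]_r) j k :
  herm_contract T' (delta_mx 0 j) (delta_mx 0 k) = T' j k.
Proof. by apply/matrixP=> l m; rewrite contractE hform_delta mxE. Qed.

Lemma griffiths_coef_conj j k j' k' :
  (second_chern_coef T j k j' k')^* = second_chern_coef T k j k' j'.
Proof.
have [T' pT' [Q Qu T'E]] := unitary_frame_exists.
have E a b a' b' : second_chern_coef T a b a' b' = second_chern_coef T' a b a' b'.
  rewrite /second_chern_coef -!(contract_delta T') !T'E mulmx_conjmx //.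
  by rewrite !mxtrace_conjmx // !contract_delta.
by rewrite !E second_chern_coef_conj.
Qed.

Lemma griffiths_contract_ge0 x y :
  0 <= \tr (herm_contract T x x) * \tr (herm_contract T y y)
       - \tr (herm_contract T x y) * \tr (herm_contract T y x)
       - (\tr (herm_contract T x x *m herm_contract T y y)
          - \tr (herm_contract T x y *m herm_contract T y x)).
Proof.
have [T' pT' [Q Qu T'E]] := unitary_frame_exists.
have := second_chern_contract_ge0 pT' x y.
by rewrite !T'E !mulmx_conjmx // !mxtrace_conjmx.
Qed.

(* The left-hand side is the coefficient of the volume form in the product of
   the second Chern form with [i^(q^2) beta \bar beta], when
   [dz_j dz_j' beta = (x_j y_j' - x_j' y_j) dz_1 ... dz_n]. *)
Lemma griffiths_coef_sum_ge0 (x y : 'rV[C]_n)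
    (D := fun j j' => x 0 j * y 0 j' - x 0 j' * y 0 j) :
  0 <= \sum_j \sum_k \sum_j' \sum_k'
    second_chern_coef T j k j' k' * (D j j' * (D k k')^*).
Proof.
pose g (u v u' v' : 'rV[C]_n) :=
  \tr (herm_contract T u v) * \tr (herm_contract T u' v')
    - \tr (herm_contract T u v *m herm_contract T u' v').
have gE u v u' v' : g u v u' v' = \sum_j \sum_k \sum_j' \sum_k'
    second_chern_coef T j k j' k' * (u 0 j * (v 0 k)^* * (u' 0 j' * (v' 0 k')^*)).
  have trE (L : {linear 'M[C]_r -> C^o}) a b : L (herm_contract T a b) =
      \sum_j \sum_k (a 0 j * (b 0 k)^*) * L (T j k).
    rewrite /herm_contract linear_sum; apply: eq_bigr => j _.
    by rewrite linear_sum; apply: eq_bigr => k _; rewrite linearZ.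
  (* [g] is this bilinear expression at two contractions. Packing its partial applications as linear
     maps lets [trE] expand one argument at a time. *)
  pose L (A B : 'M[C]_r) : C^o := \tr A * \tr B - \tr (A *m B).
  have Ll B : linear (L^~ B).
    move=> c A A'; rewrite /L linearP /= mulmxDl -scalemxAl linearP /=.
    by rewrite /GRing.scale /=; ring.
  have Lr A : linear (L A).
    move=> c B B'; rewrite /L linearP /= mulmxDr -scalemxAr linearP /=.
    by rewrite /GRing.scale /=; ring.
  pose Lll B : {linear 'M[C]_r -> C^o} := HB.pack (L^~ B)
    (GRing.isLinear.Build _ _ _ _ _ (Ll B)).
  pose Llr A : {linear 'M[C]_r -> C^o} := HB.pack (L A)
    (GRing.isLinear.Build _ _ _ _ _ (Lr A)).
  rewrite -[LHS]/(Lll _ _) trE; apply: eq_bigr => j _; apply: eq_bigr => k _.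
  rewrite -[Lll _ _]/(Llr _ _) trE mulr_sumr; apply: eq_bigr => j' _.
  rewrite mulr_sumr; apply: eq_bigr => k' _.
  by rewrite -[Llr _ _]/(second_chern_coef T j k j' k'); ring.
(* The product of D_jj' and conj(D_kk') has four terms, which give four values of [g]. By
   commutativity and cyclicity of the trace they agree in pairs, and the sum is twice the quantity
   of [griffiths_contract_ge0]. *)
have -> : \sum_j \sum_k \sum_j' \sum_k'
    second_chern_coef T j k j' k' * (D j j' * (D k k')^*) =
  g x x y y - g x y y x - g y x x y + g y y x x.
  rewrite !gE -!(sumrB, big_split) /=; apply: eq_bigr => j _.
  rewrite -!(sumrB, big_split) /=; apply: eq_bigr => k _.
  rewrite -!(sumrB, big_split) /=; apply: eq_bigr => j' _.
  rewrite -!(sumrB, big_split) /=; apply: eq_bigr => k' _.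
  rewrite /D rmorphB !rmorphM /=; ring.
have := griffiths_contract_ge0 x y.
rewrite -(@pmulr_rge0 _ 2) ?ltr0n //; congr (_ <= _).
rewrite /g (mxtrace_mulC (herm_contract T y y)) (mxtrace_mulC (herm_contract T y x)); ring.
Qed.

End ArbitraryFrame.

End Curvature.
End SemipositiveMatrices.

(** * The exterior algebra *)

Section ExteriorBasis.
Variables (K : comNzRingType) (N : nat).
Implicit Types (A B D : {set 'I_N}) (u v : ext K N).

Lemma ext_basisM A B :
  ext_basis K A * ext_basis K B = wedge_sign K A B *: ext_basis K (A :|: B).
Proof.
apply/ffunP=> D; rewrite !ffunE (bigD1 A) //= (bigD1 B) //=.
rewrite !ffunE !eqxx !mulr1 [X in _ + X + _]big1 ?addr0 => [|F /negPf nF]; last first.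
  by rewrite !ffunE nF !mulr0.
rewrite big1 ?addr0 => [|F /negPf nF]; last first.
  by rewrite big1 // => G _; rewrite !ffunE nF mul0r !mulr0.
by rewrite mulrC eq_sym.
Qed.

Lemma ext_scaleE (c : K) u A : (c *: u) A = c * u A.
Proof. by rewrite ffunE. Qed.

Lemma ext_basis_sum u : u = \sum_A u A *: ext_basis K A.
Proof.
apply/ffunP=> D; rewrite sum_ffunE (bigD1 D) //= big1 ?addr0 => [|A /negPf nA].
  by rewrite !ffunE eqxx /GRing.scale /= mulr1.
by rewrite !ffunE eq_sym nA /GRing.scale /= mulr0.
Qed.

Lemma ext_basis_single u A :
  (forall D, D != A -> u D = 0) -> u = u A *: ext_basis K A.
Proof.
move=> hu; apply/ffunP=> D; rewrite ext_scaleE ffunE.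
by case: eqVneq => [->|/hu ->]; rewrite ?mulr1 ?mulr0.
Qed.

Lemma index_enum_ordE : index_enum 'I_N = enum 'I_N.
Proof. by rewrite [index_enum _]unlock enumT. Qed.

Lemma inversions1l i B :
  inversions [set i] B = count (fun k => (k \in B) && (k < i)%N) (enum 'I_N).
Proof.
rewrite /inversions.
have -> : [set p : 'I_N * 'I_N | [&& p.1 \in [set i], p.2 \in B & (p.2 < p.1)%N]]
  = [set (i, k) | k in [set k in B | (k < i)%N]].
  apply/setP=> -[a b]; rewrite !inE /=; apply/idP/imsetP => [/and3P[/eqP -> bB bi]|].
    by exists b; rewrite // inE bB.
  by case=> k; rewrite inE => /andP[kB ki] [-> ->]; rewrite eqxx kB.
rewrite card_imset => [|a b []//]; rewrite cardE size_filter enumT.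
by apply: eq_count => k; rewrite -[LHS]/(k \in _) inE.
Qed.

Lemma enum_ord_pairwise : pairwise (fun a b : 'I_N => (a < b)%N) (enum 'I_N).
Proof.
have := iota_ltn_sorted 0 N; rewrite -val_enum_ord sorted_pairwise; last exact: ltn_trans.
by rewrite pairwise_map.
Qed.

End ExteriorBasis.

(** * Monomials in anticommuting elements of square zero *)

Section AnticommutingProducts.
Variables (K : comNzRingType) (S : algType K) (N : nat) (g : 'I_N -> S).
Hypothesis g_anti : forall i j, g i * g j = - (g j * g i).
Hypothesis g_sqr : forall i, g i * g i = 0.

Definition gprod (A : {set 'I_N}) : S := \prod_(k < N | k \in A) g k.

(** The factor [g i] moves right, with one sign for each smaller index in B, until it reaches its
    place or meets itself and vanishes. Stating this along any increasing sequence makes the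
    induction possible. *)
Lemma gprod_seq1 i (B : {set 'I_N}) (s : seq 'I_N) :
  pairwise (fun a b : 'I_N => (a < b)%N) s -> i \in s ->
  g i * \prod_(k <- s | k \in B) g k =
  if i \in B then 0 else
  (-1) ^+ count (fun k => (k \in B) && (k < i)%N) s
    *: \prod_(k <- s | k \in i |: B) g k.
Proof.
elim: s => [//|a s IH] /= /andP[/allP as_lt ss]; rewrite inE.
have [-> _|ia /= i_s] := eqVneq i a.
  rewrite !big_cons setU11 ltnn andbF add0n; case: ifP => aB.
    by rewrite mulrA g_sqr mul0r.
  have -> : count (fun k => (k \in B) && (k < a)%N) s = 0%N.
    rewrite -(@eq_in_count _ pred0) ?count_pred0 // => k /as_lt ak.
    by rewrite ltnNge (ltnW ak) andbF.
  rewrite expr0 scale1r; congr (_ * _).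
  rewrite [LHS]big_seq_cond [RHS]big_seq_cond; apply: eq_bigl => k.
  case: (boolP (k \in s)) => //= ks; rewrite in_setU1.
  by case: eqVneq ks => // -> /as_lt; rewrite ltnn.
rewrite !big_cons in_setU1 eq_sym (negPf ia) /=.
have ai : (a < i)%N := as_lt i i_s.
case: (boolP (a \in B)) => aB /=; last by rewrite add0n IH.
rewrite mulrA g_anti mulNr -mulrA IH // ai.
by case: ifP => _; rewrite ?mulr0 ?oppr0 // exprS mulN1r scaleNr -scalerAr.
Qed.

Lemma gprod1M i (B : {set 'I_N}) :
  g i * gprod B = wedge_sign K [set i] B *: gprod (i |: B).
Proof.
rewrite /gprod index_enum_ordE (gprod_seq1 _ (enum_ord_pairwise N)) ?mem_enum //.
rewrite /wedge_sign disjoints1 inversions1l; case: ifP => _ //=.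
by rewrite scale0r.
Qed.

Lemma wedge_sign_sqr (A B : {set 'I_N}) : [disjoint A & B] ->
  wedge_sign K A B * wedge_sign K A B = 1.
Proof. by move=> dAB; rewrite /wedge_sign dAB -expr2 sqrr_sign. Qed.

(** Such monomials multiply with the same signs as the basis of the exterior algebra, which is what
    makes [ext_lift] multiplicative. One index of A is split off at a time, and [wedge_signA]
    recombines the signs. *)
Lemma gprodM (A B : {set 'I_N}) :
  gprod A * gprod B = wedge_sign K A B *: gprod (A :|: B).
Proof.
have [n] := ubnP #|A|; elim: n A => // n IH A; rewrite ltnS => leA.
have [->|[i iA]] := set_0Vmem A.
  by rewrite wedge_signE0 scale1r set0U {1}/gprod big_pred0 ?mul1r // => k; rewrite inE.
have dA : [disjoint [set i] & A :\ i] by rewrite disjoints1 !inE eqxx.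
have AE : gprod A = wedge_sign K [set i] (A :\ i) *: (g i * gprod (A :\ i)).
  by rewrite gprod1M scalerA wedge_sign_sqr // scale1r setD1K.
rewrite AE -scalerAl -mulrA IH; last by rewrite (leq_trans _ leA) // [leqRHS](cardsD1 i) iA.
rewrite -scalerAr gprod1M !scalerA -mulrA -wedge_signA setUA setD1K //.
by rewrite mulrA wedge_sign_sqr // mul1r.
Qed.
End AnticommutingProducts.

Section Generators.
Variables (K : comNzRingType) (N : nat).
Local Notation gen := (@ext_gen K N).

Lemma ext_gen_anti i j : gen i * gen j = - (gen j * gen i).
Proof.
rewrite /ext_gen !ext_basisM setUC -scaleNr; congr (_ *: _).
rewrite /wedge_sign !disjoints1 !inE [j == i]eq_sym; case: eqVneq => [_|ij] /=.
  by rewrite oppr0.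
suff c1 (a b : 'I_N) : inversions [set a] [set b] = (b < a)%N.
  rewrite !c1 ltnNge leq_eqVlt -(inj_eq val_inj) in ij *.
  by rewrite (negPf ij); case: ltnP; rewrite /= ?expr0 ?expr1 ?opprK.
rewrite inversions1l; transitivity (count (fun k => (k == b) && (b < a)%N) (enum 'I_N)).
  by apply: eq_count => k; rewrite inE; case: eqVneq => // ->.
case: ltnP => _; last by rewrite -(@eq_count _ pred0) ?count_pred0 // => k; rewrite andbF.
rewrite -(@eq_count _ (pred1 b)) => [|k]; last by rewrite /= andbT.
by rewrite count_uniq_mem ?enum_uniq ?mem_enum.
Qed.

Lemma ext_gen_sqr i : gen i * gen i = 0.
Proof. by rewrite ext_basisM /wedge_sign disjoints1 !inE eqxx scale0r. Qed.

Lemma ext_basis_prod A : ext_basis K A = gprod gen A.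
Proof.
have [n] := ubnP #|A|; elim: n A => // n IH A; rewrite ltnS => leA.
have [->|[i iA]] := set_0Vmem A.
  by rewrite /gprod big_pred0 // => k; rewrite inE.
have dA : [disjoint [set i] & A :\ i] by rewrite disjoints1 !inE eqxx.
have := gprod1M ext_gen_anti ext_gen_sqr i (A :\ i).
rewrite -IH; last by rewrite (leq_trans _ leA) // [leqRHS](cardsD1 i) iA.
rewrite ext_basisM setD1K // => e.
rewrite -[RHS]scale1r -(wedge_sign_sqr K dA) -[RHS]scalerA -e scalerA.
by rewrite wedge_sign_sqr // scale1r.
Qed.

End Generators.

(** * Semilinear universal property of the exterior algebra *)

Section AntilinearExtension.
Variables (K : comNzRingType) (N : nat) (S : algType K).
Variables (sigma : {rmorphism K -> K}) (g : 'I_N -> S).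
Hypothesis g_anti : forall i j, g i * g j = - (g j * g i).
Hypothesis g_sqr : forall i, g i * g i = 0.
Implicit Types (u v : ext K N).

(** The [sigma]-semilinear ring morphism determined by the images [g] of the generators. Complex
    conjugation for [sigma] and [swap_gen] for [g] give [conj_form]. *)
Definition ext_lift u : S := \sum_A sigma (u A) *: gprod g A.

Lemma ext_lift_is_additive : zmod_morphism ext_lift.
Proof.
move=> u v; rewrite /ext_lift -sumrB; apply: eq_bigr => A _.
by rewrite !ffunE rmorphB scalerBl.
Qed.

HB.instance Definition _ := GRing.isZmodMorphism.Build _ _ ext_lift ext_lift_is_additive.

Lemma ext_liftZ c u : ext_lift (c *: u) = sigma c *: ext_lift u.
Proof.
rewrite /ext_lift scaler_sumr; apply: eq_bigr => A _.
by rewrite ext_scaleE rmorphM scalerA.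
Qed.

Lemma ext_lift_basis A : ext_lift (ext_basis K A) = gprod g A.
Proof.
rewrite /ext_lift (bigD1 A) //= big1 ?addr0 => [|B /negPf nB].
  by rewrite ffunE eqxx rmorph1 scale1r.
by rewrite ffunE nB rmorph0 scale0r.
Qed.

Lemma ext_liftM u v : ext_lift (u * v) = ext_lift u * ext_lift v.
Proof.
rewrite [u]ext_basis_sum mulr_suml !raddf_sum mulr_suml; apply: eq_bigr => A _ /=.
rewrite [v]ext_basis_sum mulr_sumr !raddf_sum mulr_sumr; apply: eq_bigr => B _ /=.
rewrite -scalerAr -scalerAl !ext_liftZ -scalerAr -scalerAl ext_basisM ext_liftZ.
rewrite !ext_lift_basis gprodM //; congr (_ *: (_ *: _)).
rewrite /wedge_sign; case: ifP => _; last by rewrite rmorph0 scale0r.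
by rewrite rmorphXn rmorphN1.
Qed.

Lemma ext_lift1 : ext_lift 1 = 1.
Proof. by rewrite ext_lift_basis /gprod big_pred0 // => k; rewrite inE. Qed.

End AntilinearExtension.

(** * Forms on C^n *)

Section ConjugationOfForms.
Variables (R : realType) (n : nat).
Local Notation C := (Cplx R).
Local Notation dz := (@dz R n).
Local Notation dzb := (@dzbar R n).
Local Notation form := (cform R n).
Implicit Types u v : form.

Lemma dz_anti i j : dz i * dz j = - (dz j * dz i).
Proof. exact: ext_gen_anti. Qed.

Lemma dzbar_anti i j : dzb i * dzb j = - (dzb j * dzb i).
Proof. exact: ext_gen_anti. Qed.

Lemma dz_dzbar_anti i j : dz i * dzb j = - (dzb j * dz i).
Proof. exact: ext_gen_anti. Qed.

Lemma swap_gen_anti i j :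
  swap_gen R i * swap_gen R j = - (swap_gen R j * swap_gen R i) :> form.
Proof. by rewrite /swap_gen; case: split => ?; case: split => ?; exact: ext_gen_anti. Qed.

Lemma swap_gen_sqr i : swap_gen R i * swap_gen R i = 0 :> form.
Proof. by rewrite /swap_gen; case: split => ?; exact: ext_gen_sqr. Qed.

Lemma conj_formE u : conj_form u = ext_lift (@Num.conj C) (@swap_gen R n) u.
Proof. by []. Qed.

Lemma conj_form_sum (I : Type) (s : seq I) (P : pred I) (F : I -> form) :
  conj_form (\sum_(i <- s | P i) F i) = \sum_(i <- s | P i) conj_form (F i).
Proof. by rewrite conj_formE raddf_sum. Qed.

Lemma conj_formZ (c : C) u : conj_form (c *: u) = c^* *: conj_form u.
Proof. by rewrite conj_formE ext_liftZ. Qed.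

Lemma conj_formM u v : conj_form (u * v) = conj_form u * conj_form v.
Proof. by rewrite conj_formE ext_liftM //; [exact: swap_gen_anti | exact: swap_gen_sqr]. Qed.

Lemma conj_form1 : conj_form (1 : form) = 1.
Proof. by rewrite conj_formE ext_lift1. Qed.

Lemma conj_form_prod (I : Type) (s : seq I) (P : pred I) (F : I -> form) :
  conj_form (\prod_(i <- s | P i) F i) = \prod_(i <- s | P i) conj_form (F i).
Proof. exact: (big_morph _ conj_formM conj_form1). Qed.

Lemma conj_ext_gen k : conj_form (ext_gen C k : form) = swap_gen R k.
Proof.
rewrite conj_formE /ext_gen ext_lift_basis /gprod.
by rewrite (big_pred1 k) // => i; rewrite /= inE.
Qed.

Lemma conj_dz j : conj_form (dz j) = dzb j.
Proof. by rewrite conj_ext_gen /swap_gen (unsplitK (inl j)). Qed.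

Lemma conj_dzbar j : conj_form (dzb j) = dz j.
Proof. by rewrite conj_ext_gen /swap_gen (unsplitK (inr j)). Qed.

End ConjugationOfForms.

(** * Bidegree and holomorphic forms of top degree *)

Section Bidegree.
Variables (R : realType) (n : nat).
Local Notation C := (Cplx R).
Local Notation dz := (@dz R n).
Local Notation dzb := (@dzbar R n).
Local Notation form := (cform R n).
Implicit Types u v : form.

Lemma has_bidegree0 p q : has_bidegree p q (0 : form).
Proof. by move=> A; rewrite ffunE eqxx. Qed.

Lemma has_bidegreeD p q u v :
  has_bidegree p q u -> has_bidegree p q v -> has_bidegree p q (u + v).
Proof.
move=> hu hv A; rewrite ffunE; have [u0|un _] := eqVneq (u A) 0; last exact: hu.
by rewrite u0 add0r; apply: hv.
Qed.

Lemma has_bidegreeZ p q (c : C) u : has_bidegree p q u -> has_bidegree p q (c *: u).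
Proof. by move=> hu A; rewrite ext_scaleE mulf_eq0 negb_or => /andP[_]; apply: hu. Qed.

Lemma has_bidegree_sum p q (I : Type) (s : seq I) (P : pred I) (F : I -> form) :
  (forall i, P i -> has_bidegree p q (F i)) ->
  has_bidegree p q (\sum_(i <- s | P i) F i).
Proof.
by move=> h; apply: big_ind => //; [exact: has_bidegree0 | exact: has_bidegreeD].
Qed.

Lemma card_preimU (f : 'I_n -> 'I_(n + n)) (A B : {set 'I_(n + n)}) :
  [disjoint A & B] ->
  #|[set j | f j \in A :|: B]| = (#|[set j | f j \in A]| + #|[set j | f j \in B]|)%N.
Proof.
move=> dAB; have -> : [set j | f j \in A :|: B] = [set j | f j \in A] :|: [set j | f j \in B].
  by apply/setP=> j; rewrite !inE.
rewrite cardsU; suff -> : [set j | f j \in A] :&: [set j | f j \in B] = set0.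
  by rewrite cards0 subn0.
apply/setP=> j; rewrite !inE; apply/negP=> /andP[jA].
by rewrite (disjointFr dAB jA).
Qed.

(** A nonzero coefficient of the product at D needs disjoint A and B with union D at which [u] and
    [v] are nonzero; the counts then add. *)
Lemma has_bidegreeM p q p' q' u v :
  has_bidegree p q u -> has_bidegree p' q' v -> has_bidegree (p + p') (q + q') (u * v).
Proof.
move=> hu hv D; rewrite ffunE => nz.
have [A nzA] : exists A, \sum_B (A :|: B == D)%:R * (wedge_sign C A B * (u A * v B)) != 0.
  apply/existsP; rewrite -negb_forall; apply: contra nz => /forallP z.
  by rewrite big1 // => A _; apply/eqP/z.
have [B] : exists B, (A :|: B == D)%:R * (wedge_sign C A B * (u A * v B)) != 0.
  apply/existsP; rewrite -negb_forall; apply: contra nzA => /forallP z.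
  by rewrite big1 // => B _; apply/eqP/z.
rewrite !mulf_eq0 !negb_or => /and4P[]; case: (A :|: B =P D) => [<- _|_]; last by rewrite eqxx.
rewrite /wedge_sign; case: ifP => [dAB _ uA vB|_]; last by rewrite eqxx.
by have [<- <-] := hu _ uA; have [<- <-] := hv _ vB; rewrite !card_preimU.
Qed.

Lemma has_bidegree1 : has_bidegree 0 0 (1 : form).
Proof.
move=> A; rewrite ffunE; case: (A =P set0) => [-> _|_]; last by rewrite eqxx.
by split; apply: eq_card0 => j; rewrite !inE.
Qed.

Lemma has_bidegree_dz j : has_bidegree 1 0 (dz j).
Proof.
move=> A; rewrite ffunE; case: (A =P _) => [-> _|_]; last by rewrite eqxx.
split; last by apply: eq_card0 => k; rewrite !inE eq_rlshift.
by rewrite -(cards1 j); apply: eq_card => k; rewrite !inE eq_lshift.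
Qed.

Lemma has_bidegree_dzbar j : has_bidegree 0 1 (dzb j).
Proof.
move=> A; rewrite ffunE; case: (A =P _) => [-> _|_]; last by rewrite eqxx.
split; first by apply: eq_card0 => k; rewrite !inE eq_lrshift.
by rewrite -(cards1 j); apply: eq_card => k; rewrite !inE eq_rshift.
Qed.

Lemma has_bidegree_linear_form b : has_bidegree 1 0 (linear_form (n := n) b : form).
Proof. by apply: has_bidegree_sum => k _; apply/has_bidegreeZ/has_bidegree_dz. Qed.

Definition hol_volume : form := \prod_(j < n) dz j.

Lemma hol_volumeE : hol_volume = ext_basis C (@lshift n n @: setT).
Proof.
rewrite ext_basis_prod /gprod big_split_ord /=.
rewrite [X in _ * X]big_pred0 ?mulr1 => [|j].
  by apply: eq_bigl => j; rewrite imset_f.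
by apply/negbTE/imsetP=> -[k _ /eqP]; rewrite eq_rlshift.
Qed.

(** A monomial of bidegree (n, 0) contains every dz_j and no dzbar_j, so only one coefficient can be
    nonzero. *)
Lemma hol_volume_generates u : has_bidegree n 0 u -> exists c : C, u = c *: hol_volume.
Proof.
move=> hu; exists (u (@lshift n n @: setT)); rewrite hol_volumeE.
apply: ext_basis_single => A nA.
have [//|/hu[hl hr]] := eqVneq (u A) 0.
case/eqP: nA; apply/setP=> k; rewrite -(splitK k); case: (split k) => j /=.
  rewrite imset_f //; have /setP/(_ j) : [set j | lshift n j \in A] = setT.
    by apply/eqP; rewrite eqEcard subsetT cardsT card_ord hl leqnn.
  by rewrite !inE.
have -> : rshift n j \in A = false.
  by apply/negbTE; have /setP/(_ j) := cards0_eq hr; rewrite !inE => ->.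
by apply/esym/negbTE/imsetP=> -[k' _ /eqP]; rewrite eq_rlshift.
Qed.

Lemma linear_form_is_linear : linear (linear_form (n := n) : 'rV[C]_n -> form).
Proof.
move=> c a b; rewrite /linear_form scaler_sumr -big_split; apply: eq_bigr => k _ /=.
by rewrite !mxE scalerDl scalerA.
Qed.

HB.instance Definition _ := GRing.isLinear.Build C 'rV[C]_n form _
  (linear_form (n := n)) linear_form_is_linear.

Lemma linear_form_delta j : linear_form (delta_mx 0 j) = dz j.
Proof.
rewrite /linear_form (bigD1 j) //= big1 ?addr0 => [|k /negPf nk].
  by rewrite mxE !eqxx scale1r.
by rewrite mxE nk andbF scale0r.
Qed.

Lemma linear_form_anti (a b : 'rV[C]_n) :
  linear_form a * linear_form b = - (linear_form b * linear_form a) :> form.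
Proof.
rewrite /linear_form !mulr_suml -sumrN.
under [RHS]eq_bigr do rewrite mulr_sumr -sumrN.
rewrite exchange_big; apply: eq_bigr => i _ /=; rewrite mulr_sumr; apply: eq_bigr => j _.
by rewrite -!scalerAl -!scalerAr dz_anti scalerN !scalerN !scalerA mulrC.
Qed.

Lemma linear_form_sqr (a : 'rV[C]_n) : linear_form a * linear_form a = 0 :> form.
Proof.
have /eqP := linear_form_anti a a; rewrite -addr_eq0 -mulr2n -scaler_nat.
by rewrite scaler_eq0 pnatr_eq0 => /eqP.
Qed.

End Bidegree.

Lemma vspace2_span (F : fieldType) (vT : vectType F) (U : {vspace vT}) : \dim U = 2%N ->
  exists r1 r2 : vT, forall u, u \in U -> exists a b, u = a *: r1 + b *: r2.
Proof.
move=> dU; have := span_basis (vbasisP U).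
have : size (vbasis U) = 2%N by rewrite size_tuple.
case: (vbasis U : seq _) => [|r1 [|r2 []]] //= _ <-; exists r1, r2 => u.
rewrite span_cons span_seq1 => /memv_addP[_ /vlineP[a ->] [_ /vlineP[b ->] ->]].
by exists a, b.
Qed.

(** * Products of n - 2 linear forms *)

Section AlternatingProducts.
Variables (K : fieldType) (n : nat) (S : algType K) (L : {linear 'rV[K]_n -> S}).
Hypothesis L_sqr : forall a, L a * L a = 0.
Implicit Types (a b v w : 'rV[K]_n) (X : seq 'rV[K]_n).

Lemma alternating_anti a b : L a * L b = - (L b * L a).
Proof.
have := L_sqr (a + b); rewrite linearD mulrDl !mulrDr !L_sqr add0r addr0.
by move/eqP; rewrite addr_eq0 => /eqP.
Qed.

Lemma alternating_mul_prod_span X v : v \in <<X>>%VS ->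
  L v * \prod_(b <- X) L b = 0.
Proof.
have base b : b \in X -> L b * \prod_(b <- X) L b = 0.
  elim: X => // a X IH; rewrite inE big_cons; case: eqVneq => [-> _|_ /= /IH e].
    by rewrite mulrA L_sqr mul0r.
  by rewrite mulrA alternating_anti mulNr -mulrA e mulr0 oppr0.
move=> vX; rewrite (coord_span (X := in_tuple X) vX) linear_sum mulr_suml big1 // => i _.
by rewrite linearZ -scalerAl base ?scaler0 //; apply: mem_nth.
Qed.

Lemma alternating_prod_free X : free X \/ \prod_(b <- X) L b = 0.
Proof.
elim: X => [|a X [fX|e]]; first by left; rewrite nil_free.
  rewrite free_cons fX andbT; case: (boolP (a \in _)) => [aX|_]; last by left.
  by right; rewrite big_cons alternating_mul_prod_span.
by right; rewrite big_cons e mulr0.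
Qed.

(* Complete the factors b_k to a basis by two vectors r1, r2; modulo the span
   of the b_k, the j-th basis vector is x_j r1 + y_j r2. *)
Lemma alternating_codim2 q (b : 'I_q -> 'rV[K]_n)
    (beta := \prod_(k < q) L (b k)) : n = q.+2 ->
  exists x y r1 r2 : 'rV[K]_n, forall j j' : 'I_n,
    L (delta_mx 0 j) * L (delta_mx 0 j') * beta =
    (x 0 j * y 0 j' - x 0 j' * y 0 j) *: (L r1 * (L r2 * beta)).
Proof.
move=> nE; set X := [seq b k | k <- enum 'I_q].
have betaE : beta = \prod_(v <- X) L v by rewrite big_map -index_enum_ordE.
(* Linearly dependent factors make [beta] zero, and then zero vectors serve as witnesses. *)
have [fX|b0] := alternating_prod_free X; last first.
  exists 0, 0, 0, 0 => j j'; rewrite betaE b0 mulr0.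
  by rewrite !mxE !mul0r subrr scale0r.
have dU : \dim <<X>>^C = 2%N.
  rewrite dimv_compl dimvf /dim /= mul1n (eqP fX) size_map size_enum_ord nE.
  by rewrite -addn2 addKn.
have [r1 [r2 rU]] := vspace2_span dU.
have decomp j : exists a : K * K, exists2 w, w \in <<X>>%VS &
    delta_mx 0 j = a.1 *: r1 + a.2 *: r2 + w :> 'rV[K]_n.
  have : delta_mx 0 j \in (<<X>>%VS + <<X>>^C)%VS :> bool by rewrite addv_complf memvf.
  case/memv_addP=> w wX [u /rU[a [c ->]] ->]; exists (a, c), w => //.
  by rewrite addrC.
have [a aP] := fin_all_exists decomp.
exists (\row_j (a j).1), (\row_j (a j).2), r1, r2 => j j'.
have wbeta w : w \in <<X>>%VS -> L w * beta = 0.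
  by rewrite betaE; apply: alternating_mul_prod_span.
have Lbeta i : L (delta_mx 0 i) * beta =
    (a i).1 *: (L r1 * beta) + (a i).2 *: (L r2 * beta).
  have [w wX ->] := aP i; rewrite !linearD !linearZ /=.
  by rewrite !mulrDl wbeta // addr0 -!scalerAl.
have LL r : L r * (L r * beta) = 0 by rewrite mulrA L_sqr mul0r.
have L2L1 : L r2 * (L r1 * beta) = - (L r1 * (L r2 * beta)).
  by rewrite !mulrA alternating_anti mulNr.
have [w wX e] := aP j; rewrite -mulrA Lbeta.
have wL r : L w * (L r * beta) = 0.
  by rewrite mulrA alternating_anti mulNr -mulrA wbeta // mulr0 oppr0.
rewrite e !linearD !linearZ /=.
rewrite !mulrDl !mulrDr -!scalerAr -!scalerAl !wL !LL L2L1.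
rewrite !scaler0 !add0r !addr0 !scalerN !scalerA -scaleNr -scalerDl !mxE.
by congr (_ *: _); ring.
Qed.

End AlternatingProducts.

Section TopDegree.
Variables (R : realType) (q : nat).
Local Notation n := q.+2.
Local Notation C := (Cplx R).
Local Notation dz := (@dz R n).
Local Notation dzb := (@dzbar R n).
Local Notation form := (cform R n).
Local Notation omega := (hol_volume R n).

Lemma has_bidegree_prod_linear_form m (X : 'I_m -> 'rV[C]_n) :
  has_bidegree m 0 (\prod_(k < m) linear_form (X k) : form).
Proof.
elim: m X => [|m IH] X; first by rewrite big_ord0; apply: has_bidegree1.
rewrite big_ord_recl; apply: (has_bidegreeM (p := 1) (p' := m) (q := 0) (q' := 0)) (IH _).
exact: has_bidegree_linear_form.
Qed.

(** The product of r1, r2 and [beta] has bidegree (n, 0), so it is d times the holomorphic volume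
    form. The 2 x 2 minors are linear in x, which therefore absorbs d. *)
Lemma dz_dz_decomposable (b : 'I_q -> 'rV[C]_n) :
  exists x y : 'rV[C]_n, forall j j' : 'I_n,
    dz j * dz j' * \prod_(k < q) linear_form (b k) =
    (x 0 j * y 0 j' - x 0 j' * y 0 j) *: omega.
Proof.
have [x [y [r1 [r2 E]]]] := alternating_codim2 (@linear_form_sqr R n) b erefl.
set beta := \prod_(k < q) _ in E *.
have [d dE] : exists d, linear_form r1 * (linear_form r2 * beta) = d *: omega.
  apply: hol_volume_generates.
  apply: (has_bidegreeM (p := 1) (p' := q.+1) (q := 0) (q' := 0)).
    exact: has_bidegree_linear_form.
  apply: (has_bidegreeM (p := 1) (p' := q) (q := 0) (q' := 0)).
    exact: has_bidegree_linear_form.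
  exact: has_bidegree_prod_linear_form.
exists (d *: x), y => j j'; rewrite -!linear_form_delta E dE scalerA !mxE.
by congr (_ *: _); ring.
Qed.

End TopDegree.

(** * Reordering signs and the trace of the second exterior power *)

Lemma prod_anticomm (S : nzRingType) m (h : 'I_m -> S) x :
  (forall i, h i * x = - (x * h i)) ->
  \prod_i h i * x = (-1) ^+ m * (x * \prod_i h i).
Proof.
elim: m h => [|m IH] h hx; first by rewrite !big_ord0 !mulr1 !mul1r.
rewrite !big_ord_recr /= -mulrA hx mulrN [in LHS]mulrA IH //.
by rewrite exprS mulN1r !mulNr !mulrA.
Qed.

(** Collecting the [f i] on the left moves [f i] past the i factors [g] of smaller index, and 0 + 1
    + ... + (m - 1) is the binomial coefficient. *)
Lemma prod_anticommuting (S : nzRingType) m (f g : 'I_m -> S) :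
  (forall i j, g i * f j = - (f j * g i)) ->
  \prod_i (f i * g i) = (-1) ^+ 'C(m, 2) * (\prod_i f i * \prod_i g i).
Proof.
elim: m f g => [|m IH] f g fg; first by rewrite !big_ord0 !mulr1.
rewrite !big_ord_recr /= IH // binS bin1.
set F := \prod_(i < m) f _; set G := \prod_(i < m) g _.
have GF : G * f ord_max = (-1) ^+ m * (f ord_max * G) by apply: prod_anticomm.
have cF : F * (-1) ^+ m = (-1) ^+ m * F by apply: commr_sign.
rewrite -!mulrA [G * (f _ * _)]mulrA GF -!mulrA [F * _]mulrA cF.
by rewrite !mulrA -exprD.
Qed.

Lemma ord2_neq0 (j : 'I_2) : j != 0 -> j = 1.
Proof. by case: j => [[|[|]]] // ? _; apply: val_inj. Qed.

(** Forms do not commute in general, so the formula is read off from the sum over permutations, with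
    the order of the factors kept. *)
Lemma det2 (S : nzRingType) (A : 'M[S]_2) :
  \det A = A 0 0 * A 1 1 - A 0 1 * A 1 0.
Proof.
rewrite /determinant (bigD1 (1%g : 'S_2)) //= (bigD1 (tperm 0 1 : 'S_2)) /=; last first.
  by apply/eqP=> /permP/(_ 0); rewrite tpermL perm1.
rewrite [X in _ + (_ + X)]big1 ?addr0; last first.
  move=> s /andP[s1 st]; have [s0|s0] := eqVneq (s 0) 0.
    case/eqP: s1; apply/permP=> i; rewrite perm1; case: (eqVneq i 0) => [->//|/ord2_neq0 ->].
    by apply: ord2_neq0; rewrite -s0 (inj_eq perm_inj).
  case/eqP: st; apply/permP=> i; case: (eqVneq i 0) => [->|/ord2_neq0 ->].
    by rewrite tpermL; apply: ord2_neq0.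
  rewrite tpermR; case: (eqVneq (s 1) 0) => // /ord2_neq0 s11.
  by have := perm_inj (etrans (ord2_neq0 s0) (esym s11)).
rewrite odd_perm1 odd_tperm /= expr0 expr1 mul1r mulN1r.
have l1 : lift ord0 ord0 = 1 :> 'I_2 by apply: val_inj.
by rewrite !big_ord_recl !big_ord0 !mulr1 !perm1 l1 tpermL tpermR.
Qed.

Lemma tr_ext_power2 (R : realType) n r (M : 'M[cform R n]_r) :
  tr_ext_power 2 M = \sum_(p : 'I_r * 'I_r | (p.1 < p.2)%N)
    (M p.1 p.1 * M p.2 p.2 - M p.1 p.2 * M p.2 p.1).
Proof.
pose fp (p : 'I_r * 'I_r) : {ffun 'I_2 -> 'I_r} := [ffun i => if i == 0 then p.1 else p.2].
rewrite /tr_ext_power (reindex fp) /=; last first.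
  exists (fun f : {ffun 'I_2 -> 'I_r} => (f 0, f 1)) => [p _|f _].
    by rewrite /fp !ffunE; case: p.
  by apply/ffunP=> i; rewrite ffunE /=; case: (eqVneq i 0) => [->|/ord2_neq0 ->].
apply: eq_big => [p|p _].
  apply/forallP/idP => [/(_ 0)/forallP/(_ 1)|lt i].
    by rewrite /fp !ffunE.
  apply/forallP=> j; apply/implyP; rewrite !ffunE.
  by case: i => [[|[|]]] //; case: j => [[|[|]]].
by rewrite /ext_power_entry det2 !mxE /fp !ffunE.
Qed.

(** * The second Chern form *)

Lemma sum_lt_sym (V : zmodType) r (F : 'I_r -> 'I_r -> V) :
  (forall l m, F l m = F m l) -> (forall l, F l l = 0) ->
  (\sum_(p : 'I_r * 'I_r | (p.1 < p.2)%N) F p.1 p.2) *+ 2 = \sum_l \sum_m F l m.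
Proof.
move=> Fs F0; rewrite pair_bigA /= [RHS](bigID (fun p : 'I_r * 'I_r => (p.1 < p.2)%N)) /=.
rewrite mulr2n; congr (_ + _).
rewrite [RHS](bigID (fun p : 'I_r * 'I_r => (p.2 < p.1)%N)) /=.
rewrite [X in _ = _ + X]big1 ?addr0 => [|[l m] /= /andP[]]; last first.
  rewrite -!leqNgt => ml lm; suff -> : l = m by [].
  by apply/val_inj/eqP; rewrite eqn_leq lm ml.
rewrite (reindex (fun p : 'I_r * 'I_r => (p.2, p.1))) /=; last first.
  by exists (fun p => (p.2, p.1)) => -[].
apply: eq_big => [[l m]|[l m] _] //=.
by case: (ltngtP l m).
Qed.

Section ChernNumerator.
Variables (K : comNzRingType) (S : algType K) (I : finType) (r : nat).
Variables (T : I -> 'M[K]_r) (eta : I -> S).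
Hypothesis eta_comm : forall i j, eta i * eta j = eta j * eta i.

Definition matrix_form l m := \sum_i T i l m *: eta i.

Lemma matrix_formM l m l' m' :
  matrix_form l m * matrix_form l' m' =
  \sum_i \sum_j (T i l m * T j l' m') *: (eta i * eta j).
Proof.
rewrite /matrix_form mulr_suml; apply: eq_bigr => i _.
rewrite mulr_sumr; apply: eq_bigr => j _.
by rewrite -scalerAl -scalerAr scalerA.
Qed.

Lemma matrix_form_comm l m l' m' :
  matrix_form l m * matrix_form l' m' = matrix_form l' m' * matrix_form l m.
Proof.
rewrite !matrix_formM exchange_big; apply: eq_bigr => i _; apply: eq_bigr => j _.
by rewrite eta_comm mulrC.
Qed.

(** Newton's identity 2 e_2 = p_1^2 - p_2 for a matrix with commuting entries, expanded in products
    of the [eta i]. Commutativity makes the principal minor symmetric in (l, m), so summing over l <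
    m gives half of the full sum. *)
Lemma matrix_form_minors :
  (\sum_(p : 'I_r * 'I_r | (p.1 < p.2)%N)
    (matrix_form p.1 p.1 * matrix_form p.2 p.2
     - matrix_form p.1 p.2 * matrix_form p.2 p.1)) *+ 2 =
  \sum_i \sum_j (\tr (T i) * \tr (T j) - \tr (T i *m T j)) *: (eta i * eta j).
Proof.
rewrite (sum_lt_sym (F := fun l m => matrix_form l l * matrix_form m m
   - matrix_form l m * matrix_form m l)); first last.
- by move=> l; rewrite subrr.
- by move=> l m; rewrite matrix_form_comm [X in _ - X]matrix_form_comm.
have trE i j : \tr (T i) * \tr (T j) - \tr (T i *m T j) =
    \sum_l \sum_m (T i l l * T j m m - T i l m * T j m l).
  rewrite /mxtrace mulr_suml -sumrB; apply: eq_bigr => l _.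
  by rewrite mulr_sumr mxE -sumrB.
under [RHS]eq_bigr do under eq_bigr do rewrite trE pair_bigA scaler_suml /=.
rewrite [LHS]pair_bigA [RHS]pair_bigA [RHS]exchange_big /=.
apply: eq_bigr => -[l m] _ /=.
rewrite !matrix_formM -sumrB -(pair_bigA _ (fun i j =>
  (T i l l * T j m m - T i l m * T j m l) *: (eta i * eta j))) /=.
apply: eq_bigr => i _.
by rewrite -sumrB; apply: eq_bigr => j _; rewrite scalerBl.
Qed.

End ChernNumerator.

Section Regroup.
Variables (K : fieldType) (S : algType K).

(** Used with a, b among the dz, c, d among the dzbar, u = beta and v = conj(beta). The only sign
    comes from exchanging c and b, since the even product c d passes u freely whatever the degree of
    u. *)
Lemma wedge_regroup (a b c d u v : S) :
  c * b = - (b * c) -> GRing.comm (c * d) u ->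
  a * c * (b * d) * (u * v) = - (a * b * u * (c * d * v)).
Proof.
move=> cb cdu; rewrite -!mulrA [c * (b * _)]mulrA cb mulNr !mulrN.
by rewrite -!mulrA [c * (d * (u * v))]mulrA [c * d * _]mulrA cdu -!mulrA.
Qed.

Lemma prodrZ_ord m (c : K) (F : 'I_m -> S) :
  \prod_i (c *: F i) = c ^+ m *: \prod_i F i.
Proof.
elim: m F => [|m IH] F; first by rewrite !big_ord0 expr0 scale1r.
by rewrite !big_ord_recl IH -scalerAl -scalerAr scalerA exprS.
Qed.

Lemma scale_sign (m : nat) (x : S) : (-1) ^+ m * x = (-1) ^+ m *: x.
Proof. by rewrite -signr_odd -[in RHS]signr_odd mulr_sign scaler_sign. Qed.

Lemma natmul2_scale (c : K) (u v : S) : (2 : K) != 0 ->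
  u *+ 2 = c *: v -> u = (c / 2) *: v.
Proof.
move=> n2 e; rewrite mulrC -scalerA -e -scaler_nat scalerA mulVf //.
by rewrite scale1r.
Qed.

Lemma scale_anti (c : K) (u v : S) : u * v = - (v * u) ->
  u * (c *: v) = - (c *: v * u).
Proof. by move=> uv; rewrite -scalerAl -scalerAr uv scalerN. Qed.

Lemma even_comm (a b c d : S) : a * c = - (c * a) -> b * c = - (c * b) ->
  b * d = - (d * b) -> a * d = - (d * a) ->
  a * b * (c * d) = c * d * (a * b).
Proof.
move=> ac bc bd ad.
rewrite -mulrA [b * _]mulrA bc mulNr -[c * b * d]mulrA bd !mulrN opprK.
by rewrite mulrA ac mulNr -[c * a * _]mulrA [a * (d * b)]mulrA ad mulNr !mulrN opprK !mulrA.
Qed.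

Lemma even_odd_comm (a b c : S) : a * c = - (c * a) -> b * c = - (c * b) ->
  GRing.comm (a * b) c.
Proof.
move=> ac bc; rewrite /GRing.comm -mulrA bc mulrN.
by rewrite [a * (c * b)]mulrA ac mulNr opprK mulrA.
Qed.
End Regroup.

(** The sign equals i^(m (m - 1)), and m + m (m - 1) = m^2. This accounts for the normalization
    i^(q^2) of beta conj(beta). *)
Lemma imaginary_exp_sqr (C : numClosedFieldType) m :
  'i ^+ m * (-1) ^+ 'C(m, 2) = 'i ^+ (m ^ 2) :> C.
Proof.
elim: m => [|m IH]; first by rewrite !expr0 mulr1.
have -> : (m.+1 ^ 2 = m ^ 2 + m + m + 1)%N by rewrite -!mulnn; lia.
rewrite binS bin1 [in LHS]exprD; move: ('C(m, 2)) IH => c IH.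
rewrite 3![in RHS]exprD -IH expr1 [in LHS]exprS.
have im : 'i ^+ m * 'i ^+ m = (-1) ^+ m :> C by rewrite -exprMn -expr2 sqrCi.
by rewrite -im; ring.
Qed.

(** * Bidegree and reality of the second Chern form *)

Section PositivityOfForms.
Variables (R : realType) (n : nat).
Local Notation C := (Cplx R).
Local Notation dz := (@dz R n).
Local Notation dzb := (@dzbar R n).
Local Notation form := (cform R n).
Local Notation omega := (hol_volume R n).

Lemma volume_formE : \prod_(j < n) ('i *: (dz j * dzb j)) =
  ('i : C) ^+ (n ^ 2) *: (omega * conj_form omega) :> form.
Proof.
rewrite prodrZ_ord prod_anticommuting; last first.
  by move=> i j; rewrite dz_dzbar_anti opprK.
rewrite scale_sign scalerA imaginary_exp_sqr /hol_volume conj_form_prod.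
by under [in RHS]eq_bigr do rewrite conj_dz.
Qed.

Definition eta (i : 'I_n * 'I_n) : form := dz i.1 * dzb i.2.

Lemma eta_comm i j : eta i * eta j = eta j * eta i.
Proof.
apply: even_comm; [exact: dz_anti | | exact: dzbar_anti | exact: dz_dzbar_anti].
by rewrite dz_dzbar_anti opprK.
Qed.

Lemma conj_eta j k : conj_form (eta (j, k)) = - eta (k, j).
Proof. by rewrite /eta conj_formM conj_dz conj_dzbar /= dz_dzbar_anti opprK. Qed.

Lemma dzbar_linear_form_anti i (b : 'rV[C]_n) :
  dzb i * linear_form b = - (linear_form b * dzb i) :> form.
Proof.
rewrite /linear_form mulr_sumr mulr_suml -sumrN; apply: eq_bigr => k _.
by apply: scale_anti; rewrite dz_dzbar_anti opprK.
Qed.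

Variables (r : nat) (T : 'I_n -> 'I_n -> 'M[C]_r).

(** The second Chern form at a point, as a function of the curvature coefficients alone; [kappa]
    stands for i / (2 pi). *)
Definition second_chern_of (kappa : C) : form :=
  tr_ext_power 2 (\matrix_(l, m) (kappa *:
    (\sum_j \sum_k T j k l m *: (dz j * dzb k)))).

Lemma second_chern_ofE kappa : second_chern_of kappa =
  (kappa ^+ 2 / 2) *: \sum_i \sum_j
    second_chern_coef T i.1 i.2 j.1 j.2 *: (eta i * eta j).
Proof.
apply: natmul2_scale; first by rewrite pnatr_eq0.
rewrite /second_chern_of tr_ext_power2; set M := \matrix_(l, m) _.
have ME l m : M l m = matrix_form (fun i : 'I_n * 'I_n => kappa *: T i.1 i.2) eta l m.
  rewrite mxE pair_bigA scaler_sumr; apply: eq_bigr => i _.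
  by rewrite mxE scalerA.
rewrite (eq_bigr _ (fun p _ => congr2 (fun u v => u - v)
  (congr2 *%R (ME p.1 p.1) (ME p.2 p.2)) (congr2 *%R (ME p.1 p.2) (ME p.2 p.1)))).
rewrite (matrix_form_minors _ eta_comm) scaler_sumr; apply: eq_bigr => i _.
rewrite scaler_sumr; apply: eq_bigr => j _; rewrite scalerA; congr (_ *: _).
rewrite !mxtraceZ -scalemxAl -scalemxAr !mxtraceZ /second_chern_coef; ring.
Qed.

Lemma has_bidegree_second_chern kappa : has_bidegree 2 2 (second_chern_of kappa).
Proof.
have eta11 i : has_bidegree 1 1 (eta i).
  apply: (has_bidegreeM (p := 1) (q := 0) (p' := 0) (q' := 1)).
    exact: has_bidegree_dz.
  exact: has_bidegree_dzbar.
rewrite second_chern_ofE; apply/has_bidegreeZ/has_bidegree_sum => i _.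
apply/has_bidegree_sum => j _; apply: has_bidegreeZ.
exact: (has_bidegreeM (p := 1) (q := 1) (p' := 1) (q' := 1)) (eta11 i) (eta11 j).
Qed.

(** Conjugation sends [eta (j, k)] to [- eta (k, j)]. In a product of two the signs cancel, and
    exchanging the indices in each pair matches the conjugated coefficients. *)
Lemma real_second_chern kappa : kappa ^+ 2 \is Num.real ->
  (forall j k j' k', (second_chern_coef T j k j' k')^* = second_chern_coef T k j k' j') ->
  real_form (second_chern_of kappa).
Proof.
move=> kr Tconj; rewrite /real_form second_chern_ofE conj_formZ; congr (_ *: _).
  by apply/CrealP; rewrite rpred_div ?realn.
rewrite conj_form_sum (reindex (fun p : 'I_n * 'I_n => (p.2, p.1))) /=; last first.
  by exists (fun p => (p.2, p.1)) => -[].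
apply: eq_bigr => -[j k] _ /=; rewrite conj_form_sum.
rewrite (reindex (fun p : 'I_n * 'I_n => (p.2, p.1))) /=; last first.
  by exists (fun p => (p.2, p.1)) => -[].
apply: eq_bigr => -[j' k'] _ /=; rewrite conj_formZ Tconj; congr (_ *: _).
by rewrite conj_formM !conj_eta mulrNN.
Qed.

End PositivityOfForms.
Section ScaledProducts.
Variables (K : comNzRingType) (S : algType K).

Lemma scale_regroup (c d d' : K) (w w' : S) :
  c *: - ((d *: w) * (d' *: w')) = - (d * d') *: (c *: (w * w')).
Proof.
by rewrite -scalerAl -scalerAr !scalerN !scalerA mulNr scaleNr; congr (- (_ *: _)); ring.
Qed.

Lemma scale_double_sum_mul (I J : finType) (c : K) (g d : I -> J -> K)
    (e : I -> J -> S) (b v : S) :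
  (forall i j, e i j * b = d i j *: v) ->
  (c *: \sum_i \sum_j g i j *: e i j) * b = (c * \sum_i \sum_j g i j * d i j) *: v.
Proof.
move=> ebv; rewrite -scalerAl -scalerA; congr (_ *: _).
rewrite mulr_suml scaler_suml; apply: eq_bigr => i _.
rewrite mulr_suml scaler_suml; apply: eq_bigr => j _.
by rewrite -scalerAl ebv scalerA.
Qed.
End ScaledProducts.

(** (q + 2)^2 - q^2 is a multiple of 4, so the volume form in dimension q + 2 and beta conj(beta)
    carry the same power of i. *)
Lemma imaginary_exp_sqrS2 (C : numClosedFieldType) q :
  'i ^+ (q.+2 ^ 2) = 'i ^+ (q ^ 2) :> C.
Proof.
have -> : (q.+2 ^ 2 = q ^ 2 + 2 * (2 * q.+1))%N by rewrite -!mulnn; lia.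
by rewrite exprD exprM sqrCi mulnC exprM sqrr_sign mulr1.
Qed.

Lemma ofreal_ge0 (R : realType) (z : Cplx R) : 0 <= z ->
  exists2 t : R, 0 <= t & z = ofreal t.
Proof.
case: z => a b; rewrite lecE /= => /andP[/eqP -> a0].
by exists a.
Qed.

Lemma ofreal_real (R : realType) (t : R) : (ofreal t : Cplx R) \is Num.real.
Proof. by rewrite realE !lecE /= eqxx le_total. Qed.

(** * Positivity against decomposable forms *)

Section Positivity.
Variables (R : realType).
Local Notation C := (Cplx R).

(** After regrouping, the two dz meet [beta] and the two dzbar meet its conjugate. Each group is a 2
    x 2 minor, or its conjugate, times half of the volume form; the minus sign is that of
    [wedge_regroup]. *)
Lemma eta_mul_volume q (b : 'I_q -> 'rV[C]_q.+2)
    (beta := \prod_(k < q) linear_form (b k)) :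
  exists x y : 'rV[C]_q.+2, forall i j,
    eta R i * eta R j * ('i ^+ (q ^ 2) *: (beta * conj_form beta)) =
    - ((x 0 i.1 * y 0 j.1 - x 0 j.1 * y 0 i.1)
       * (x 0 i.2 * y 0 j.2 - x 0 j.2 * y 0 i.2)^*)
    *: \prod_(k < q.+2) ('i *: (dz R k * dzbar R k)).
Proof.
have [x [y xyE]] := dz_dz_decomposable b; exists x, y => i j.
have xyE' k l : dzbar R k * dzbar R l * conj_form beta =
    (x 0 k * y 0 l - x 0 l * y 0 k)^* *: conj_form (hol_volume R q.+2).
  by rewrite -conj_formZ -xyE 2!conj_formM !conj_dz.
rewrite volume_formE imaginary_exp_sqrS2 -scale_regroup -xyE -xyE' -scalerAr.
congr (_ *: _); apply: wedge_regroup.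
  by rewrite dz_dzbar_anti opprK.
apply: commr_prod => k _; apply: even_odd_comm; exact: dzbar_linear_form_anti.
Qed.

Lemma positive_second_chern n r (T : 'I_n -> 'I_n -> 'M[C]_r) (kappa : C) :
  kappa ^+ 2 <= 0 ->
  (forall j k j' k', (second_chern_coef T j k j' k')^* = second_chern_coef T k j k' j') ->
  (forall x y : 'rV[C]_n, 0 <= \sum_j \sum_k \sum_j' \sum_k'
    second_chern_coef T j k j' k' * ((x 0 j * y 0 j' - x 0 j' * y 0 j)
      * (x 0 k * y 0 k' - x 0 k' * y 0 k)^*)) ->
  positive_form 2 (second_chern_of T kappa).
Proof.
move=> k0 Tconj Tpos; split.
- exact: has_bidegree_second_chern.
- by apply: real_second_chern; rewrite // ler0_real.
(* The equation has no solution for n < 2; otherwise n is [q.+2] by conversion. *)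
move=> q b nE; subst n => beta.
have [x [y xyE]] := eta_mul_volume b.
rewrite second_chern_ofE (scale_double_sum_mul _ _ xyE).
set z := (X in X *: _); suff /ofreal_ge0[t t0 ->] : 0 <= z by exists t.
have := Tpos x y; rewrite pair_bigA /=.
under eq_bigr do rewrite pair_bigA /=.
move=> le0; rewrite /z.
under eq_bigr do (under eq_bigr do rewrite mulrN; rewrite sumrN).
(* The minus sign of [eta_mul_volume] turns the nonpositive factor kappa^2 / 2 into a nonnegative
   one. *)
rewrite sumrN mulrN -mulNr mulr_ge0 // -mulNr divr_ge0 ?oppr_ge0 //.
Qed.

End Positivity.

(** * The curvature of a Hermitian holomorphic bundle *)

Section CurvatureAtPoint.
Variables (R : realType) (n : nat) (X : complexManifold R n) (r : nat).
Variables (E : holomorphicBundle X r) (h : hermitianMetric E).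
Variables (a : chart X) (s : trivialization E) (x : X).
Hypothesis xs : triv_dom s x.
Local Notation C := (Cplx R).
Local Notation e := (frame s x).

Definition frame_vec (v : 'rV[C]_r) : E x := \sum_l v 0 l *: tnth e l.

Definition frame_gram : 'M[C]_r := \matrix_(l, m) h x (tnth e l) (tnth e m).

Lemma coord_frame_vec v l : coord e l (frame_vec v) = v 0 l.
Proof.
have fe := basis_free (frame_basis xs).
rewrite /frame_vec -(coord_sum_free (fun i => v 0 i) l fe); congr (coord _ _ _).
by apply: eq_bigr => i _; rewrite (tnth_nth 0).
Qed.

Lemma herm_suml I (t : seq I) (P : pred I) (c : I -> C) (F : I -> E x) w :
  h x (\sum_(i <- t | P i) c i *: F i) w = \sum_(i <- t | P i) c i * h x (F i) w.
Proof.
have h0 : h x 0 w = 0.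
  by have := herm_linear h (-1) 0 0 w; rewrite scaler0 addr0 mulN1r addNr.
elim: t => [|i t IH]; first by rewrite !big_nil.
by rewrite !big_cons; case: ifP => // _; rewrite herm_linear IH.
Qed.

Lemma herm_sumr I (t : seq I) (P : pred I) (c : I -> C) (F : I -> E x) w :
  h x w (\sum_(i <- t | P i) c i *: F i) =
  \sum_(i <- t | P i) (c i)^* * h x w (F i).
Proof.
rewrite herm_sym herm_suml rmorph_sum; apply: eq_bigr => i _.
by rewrite rmorphM /= -herm_sym.
Qed.

Lemma herm_frame_vec u v : h x (frame_vec u) (frame_vec v) = hform frame_gram u v.
Proof.
rewrite /frame_vec herm_suml /hform mxE.
under [RHS]eq_bigr do rewrite mxE mulr_suml.
rewrite exchange_big; apply: eq_bigr => l _ /=; rewrite herm_sumr mulr_sumr.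
by apply: eq_bigr => m _; rewrite !mxE mulrA mulrAC.
Qed.

Lemma frame_gram_pos v : v != 0 -> 0 < hform frame_gram v v.
Proof.
move=> vn; rewrite -herm_frame_vec herm_pos //.
apply: contra vn => /eqP v0; apply/eqP/rowP=> l.
by rewrite -coord_frame_vec v0 linear0 mxE.
Qed.

(** Since M e_l is the sum of the M_(l,m) e_m, endomorphisms act on coordinate rows from the right.
    Hence h(Theta v, v) is the form with matrix Theta H, the product that [T_pos] asks to be
    semipositive. *)
Lemma curvature_End_frame tau v : curvature_End h a s tau (frame_vec v) =
  frame_vec (v *m herm_contract (curvature_coef h a s x) tau tau).
Proof.
rewrite /curvature_End exchange_big; apply: eq_bigr => m _ /=.
rewrite -scaler_suml mxE; congr (_ *: _); apply: eq_bigr => l _.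
rewrite coord_frame_vec; congr (_ * _).
rewrite /herm_contract summxE; apply: eq_bigr => j _; rewrite summxE.
by apply: eq_bigr => k _; rewrite [RHS]mxE mulrC.
Qed.

Lemma chern_form2E : chern_form h a s 2 x =
  second_chern_of (curvature_coef h a s x) ('i / (2 * ofreal (trigo.pi : R))).
Proof.
by congr tr_ext_power; apply/matrixP=> l m; rewrite !mxE.
Qed.

End CurvatureAtPoint.

Theorem theorem2p2 (R : realType) (n : nat) (X : complexManifold R n) (r : nat)
    (E : holomorphicBundle X r) (h : hermitianMetric E) :
  griffiths_semipositive h -> positive_chern_form h 2.
Proof.
move=> hG a s x xa xs; rewrite chern_form2E.
have Hpos := frame_gram_pos h xs.
have Tpos tau : psd (herm_contract (curvature_coef h a s x) tau tau *m frame_gram h s x).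
  move=> v; have := hG a s x xa xs (frame_vec s x v) tau.
  by rewrite curvature_End_frame // herm_frame_vec /hform mulmxA.
apply: positive_second_chern => [|j k j' k'|u v].
(* The square of i / (2 pi) is minus the square of a real number. *)
- rewrite exprMn sqrCi mulN1r oppr_le0 real_exprn_even_ge0 // realV realM ?realn //.
  exact: ofreal_real.
- exact: griffiths_coef_conj Hpos Tpos _ _ _ _.
- exact: griffiths_coef_sum_ge0 Hpos Tpos u v.
Qed.
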